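(* Let $\mu > 0$ and let $D \subset \mathbb{R}^3$ be a bounded domain (connected open set) whose complement $\mathbb{R}^3 \setminus D$ is connected. Let $r > 0$ be such that $|B_r| = |D|$, where $|\cdot|$ denotes Lebesgue measure (volume) and $B_r$ is an open ball of radius $r$. Define $$E_\mu^{+}(x,y) = \frac{\exp\{\mu|x-y|\}}{|x-y|}, \qquad E_\mu^{-}(x,y) = \frac{\exp\{-\mu|x-y|\}}{|x-y|}, \qquad x \neq y,$$ and $$a_3^+(t) = \Gamma\!\left(\tfrac{5}{2}\right)\frac{I_{3/2}(t)}{(t/2)^{3/2}},$$ where $I_{3/2}$ is the modified Bessel function of order $3/2$. Suppose that for some $x_0 \in D$ the identities $$a_3^+(\mu r)\, E_\mu^{+}(x, x_0) = \frac{1}{|D|}\int_D E_\mu^{+}(y, x)\, \mathrm{d}y \quad\text{and}\quad a_3^+(\mu r)\, E_\mu^{-}(x, x_0) = \frac{1}{|D|}\int_D E_\mu^{-}(y, x)\, \mathrm{d}y$$ both hold for every $x \in \mathbb{R}^3 \setminus D$. Then $D = B_r(x_0)$, the open ball of radius $r$ centred at $x_0$.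
   Context: $E_\mu^{\pm}$ are the two fundamental solutions of the modified Helmholtz (Yukawa) equation $\nabla^2 u - \mu^2 u = 0$ in $\mathbb{R}^3$. $B_r(x) = \{y \in \mathbb{R}^3 : |y-x| < r\}$. *)

(* Defs.v *)
From HB Require Import structures.
From mathcomp Require Import all_boot all_order all_algebra.
From mathcomp Require Import all_classical all_reals all_analysis.
Set Implicit Arguments. Unset Strict Implicit. Unset Printing Implicit Defensive.
Import Order.TTheory GRing.Theory Num.Theory.
Import numFieldNormedType.Exports.
Local Open Scope classical_set_scope.
Local Open Scope ring_scope.

(* R^3 is modelled as the triple product (R * R) * R, with its product
   topology (= Euclidean topology) and the product Lebesgue measure. *)
Definition R3 (R : realType) := ((R * R) * R)%type.

Definition edist (R : realType) (x y : R3 R) : R :=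
  Num.sqrt ((x.1.1 - y.1.1) ^+ 2 + (x.1.2 - y.1.2) ^+ 2 + (x.2 - y.2) ^+ 2).

Definition eball (R : realType) (x : R3 R) (r : R) : set (R3 R) :=
  [set y | edist y x < r].

Definition leb3 (R : realType) :=
  ((@lebesgue_measure R \x @lebesgue_measure R) \x @lebesgue_measure R)%E.

Definition ebounded (R : realType) (D : set (R3 R)) : Prop :=
  exists M : R, forall x, D x -> edist x 0 <= M.

Definition Eplus (R : realType) (mu : R) (x y : R3 R) : R :=
  expR (mu * edist x y) / edist x y.
Definition Eminus (R : realType) (mu : R) (x y : R3 R) : R :=
  expR (- (mu * edist x y)) / edist x y.

Definition Gamma (R : realType) (s : R) : R :=
  fine (\int[@lebesgue_measure R]_(t in `]0%R, +oo[)
          ((t `^ (s - 1)) * expR (- t))%:E)%E.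

Definition besselI (R : realType) (nu t : R) : R :=
  limn (series (fun k : nat =>
    (t / 2) `^ (2 * k%:R + nu) / (k`!%:R * Gamma (k%:R + nu + 1)))).

Definition a3plus (R : realType) (t : R) : R :=
  Gamma (5 / 2) * besselI (3 / 2) t / ((t / 2) `^ (3 / 2)).

(* Main.v *)
Require Import Defs.
From HB Require Import structures.
From mathcomp Require Import all_boot all_order all_algebra.
From mathcomp Require Import all_classical all_reals all_analysis.
From mathcomp Require Import measurable_realfun ring lra.
Import Order.TTheory GRing.Theory Num.Theory.
Import numFieldNormedType.Exports.
Local Open Scope classical_set_scope.
Local Open Scope ring_scope.
Set Implicit Arguments. Unset Strict Implicit. Unset Printing Implicit Defensive.
Local Notation edist := Defs.edist.

(* Integrate the identity for [E-] over a shell around [x0] that surrounds [D].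
   By Tonelli and Newton's shell theorem for the Yukawa kernel, the potential of
   the shell at an interior point [y] is a constant times
   [S y = sinh (mu |y - x0|) / (mu |y - x0|)], so the identity becomes
   [\int_D S = |D| * a3plus (mu r) = \int_B S], where [B] is the ball of radius [r]
   around [x0]. Since [S] increases with the distance to [x0] and [|D| = |B|], the
   sets [D] and [B] differ by a null set, and [D], being open, lies in [B]. At a
   point of [B] outside [D] the potential of [D] is that of [B], which is known in
   closed form and is strictly smaller than what the identity requires.

   Ball integrals of radial kernels are computed by slicing along the axis through
   the two centres; rotations preserve the product measure because they are
   products of shears, and the area of the unit disc is never evaluated. *)

(** * Maps that preserve integrals against Lebesgue and product measures *)

Section Preserve.
Context (R : realType).
Local Notation lam := (@lebesgue_measure R).
Local Notation MR := (measurableTypeR R).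

(** Averaging over a solid shell rather than a sphere keeps every step a volume integral of a
    nonnegative kernel, so Tonelli applies without integrability checks. The shell potential is a
    difference of two ball potentials, whose only term that depends on the point is a multiple of
    [S]. One slicing argument serves all kernels of the form g(t) / t: in the squared planar radius
    q, with s the distance, dq = 2 s ds cancels the denominator. Volume, Yukawa potential and the
    integral of [S] are three instances, and each carries the factor [disc_area], which therefore
    cancels. The strict inequality at the end has a reason layer by layer. With lengths scaled by
    mu, a layer at radius p acts on a point at distance d < p through [sinhc d] exp (-p) / p, while
    the exterior law would give [sinhc p] exp (-d) / d; the second exceeds the first by sinh (p - d)
    / (p d). Invariance of the measure is phrased through integrals of nonnegative measurable
    functions, the form in which Tonelli treats one coordinate at a time. *)

Definition int_preserving (d : measure_display) (T : measurableType d)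
    (m : set T -> \bar R) (f : T -> T) :=
  measurable_fun setT f /\
  forall g : T -> \bar R, measurable_fun setT g -> (forall x, 0 <= g x)%E ->
    (\int[m]_x g (f x) = \int[m]_x g x)%E.

Lemma int_preserving_comp (d : measure_display) (T : measurableType d)
    (m : set T -> \bar R) (f h : T -> T) :
  int_preserving m f -> int_preserving m h -> int_preserving m (f \o h).
Proof.
move=> [mf pf] [mh ph]; split; first exact: measurableT_comp.
move=> g mg g0 /=; rewrite -(pf g)//; apply: (ph (g \o f)) => //=.
exact: measurableT_comp.
Qed.

Lemma int_preserving_translation (k : R) :
  int_preserving (T := MR) lam (fun x => x + k).
Proof.
pose t : MR -> MR := fun x => x + k.
have mt : measurable_fun [set: MR] t by exact: measurable_funD.
split=> // g mg g0.
transitivity (\int[pushforward lam t]_x g x)%E.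
  by rewrite ge0_integral_pushforward.
apply: eq_measure_integral => //= A mA _; apply/esym.
apply: lebesgue_measure_unique => // _ [[a b]] _ <- /=.
rewrite /pushforward.
rewrite (_ : _ @^-1` _ = `]a - k, b - k]%classic); last first.
  by apply/seteqP; split=> x /=; rewrite !in_itv/= /t ltrBlDr lerBrDr.
rewrite !lebesgue_measure_itv/= !lte_fin ltrD2r.
by case: ifP => // _; rewrite -!EFinB; congr EFin; ring.
Qed.

(** For each fixed first coordinate the map is a translation of the line, so Tonelli with the line
    innermost reduces the claim to translation invariance. *)
Lemma int_preserving_shear_snd (d : measure_display) (T : measurableType d)
    (m : {sigma_finite_measure set T -> \bar R}) (phi : T -> R) :
  measurable_fun setT phi ->
  int_preserving (m \x lam)%E (fun y : T * MR => (y.1, y.2 + phi y.1)).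
Proof.
move=> mphi.
have mt : measurable_fun setT (fun y : T * MR => (y.1, (y.2 : R) + phi y.1)).
  apply: measurable_fun_pair => //=; apply: measurable_funD => //.
  exact: measurableT_comp.
split=> // g mg g0.
rewrite fubini_tonelli1//; last exact: measurableT_comp mg mt.
rewrite [RHS](fubini_tonelli1 g)//; apply: eq_integral => x _.
rewrite /fubini_F /=.
have [_ /(_ (fun y => g (x, y)))] := int_preserving_translation (phi x).
by apply => //; apply: measurableT_comp.
Qed.

(** Tonelli with the last coordinate outermost leaves one map [s c] for each fixed [c], so [s] may
    be any jointly measurable family of preserving maps. This lifts planar shears to space. *)
Lemma int_preserving_shear_fst (d : measure_display) (T : measurableType d)
    (m : {sigma_finite_measure set T -> \bar R}) (s : R -> T -> T) :
  measurable_fun setT (fun y : T * MR => s y.2 y.1) ->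
  (forall c, int_preserving m (s c)) ->
  int_preserving (m \x lam)%E (fun y : T * MR => (s y.2 y.1, y.2)).
Proof.
move=> ms ps.
have mt : measurable_fun setT (fun y : T * MR => (s y.2 y.1, y.2)).
  by apply: measurable_fun_pair.
split=> // g mg g0.
rewrite fubini_tonelli2//; last exact: measurableT_comp mg mt.
rewrite [RHS](fubini_tonelli2 g)//; apply: eq_integral => x _.
rewrite /fubini_G /=.
have [_ /(_ (fun y => g (y, x)))] := ps x.
by apply => //; apply: measurableT_comp.
Qed.

End Preserve.

(** Rectangles built from two increasing exhausting sequences exhaust the product. It lets a product
    measure be a factor of a further product: the plane in space, and space in the pairing of the
    shell with [D]. *)
Lemma sigma_finite_product_measure (d1 d2 : measure_display)
    (T1 : measurableType d1) (T2 : measurableType d2) (R : realType)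
    (m1 : {sigma_finite_measure set T1 -> \bar R})
    (m2 : {sigma_finite_measure set T2 -> \bar R}) :
  sigma_finite setT (m1 \x m2)%E.
Proof.
have /sigma_finiteP[F [TF ndF Foo]] := sigma_finiteT m1.
have /sigma_finiteP[G [TG ndG Goo]] := sigma_finiteT m2.
exists (fun n => F n `*` G n).
  rewrite -setXTT TF TG; apply/seteqP; split=> -[x y] /=.
    move=> [[n _ Fnx] [k _ Gky]]; exists (maxn n k) => //; split => /=.
      by move: x Fnx; exact/subsetPset/ndF/leq_maxl.
    by move: y Gky; exact/subsetPset/ndG/leq_maxr.
  by move=> [n _ [? ?]]; split; exists n.
move=> k; have [mF Fk] := Foo k; have [mG Gk] := Goo k.
split; first exact: measurableX.
by rewrite product_measure1E// lte_mul_pinfty// ge0_fin_numE.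
Qed.

(** * Lebesgue measure on the plane and on space *)

Section lebesgue23.
Context (R : realType).
Local Notation lam := (@lebesgue_measure R).
Local Notation MR := (measurableTypeR R).
Local Notation MR3 := ((MR * MR) * MR)%type.

(** A named constant is what carries the sigma-finite instance. It unfolds to the plain product, so
    [leb3E] holds by conversion. *)
Definition lebesgue2 : set (MR * MR)%type -> \bar R := (lam \x lam)%E.
HB.instance Definition _ := Measure.on lebesgue2.
HB.instance Definition _ := Measure_isSigmaFinite.Build _ _ _ lebesgue2
  (sigma_finite_product_measure lam lam).

Definition lebesgue3 : set MR3 -> \bar R := (lebesgue2 \x lam)%E.
HB.instance Definition _ := Measure.on lebesgue3.
HB.instance Definition _ := Measure_isSigmaFinite.Build _ _ _ lebesgue3
  (sigma_finite_product_measure lebesgue2 lam).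

End lebesgue23.

(** * Shears and rotations of space *)

Section Iso.
Context (R : realType).
Local Notation lam := (@lebesgue_measure R).
Local Notation MR := (measurableTypeR R).
Local Notation MR3 := ((MR * MR) * MR)%type.

Lemma leb3E : @leb3 R = @lebesgue3 R.
Proof. by []. Qed.

Lemma int_preserving_shear3 (phi : MR * MR -> R) : measurable_fun setT phi ->
  int_preserving (@lebesgue3 R) (fun y => (y.1, y.2 + phi y.1)).
Proof. exact: int_preserving_shear_snd. Qed.

Lemma int_preserving_shear2 (phi : MR -> R) : measurable_fun setT phi ->
  int_preserving (@lebesgue3 R) (fun y => ((y.1.1, y.1.2 + phi y.2), y.2)).
Proof.
move=> mphi.
apply: (@int_preserving_shear_fst R _ _ (@lebesgue2 R)
  (fun c y => (y.1, y.2 + phi c))) => //.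
  apply: measurable_fun_pair => //=.
    exact: measurableT_comp.
  apply: measurable_funD => /=; first exact: measurableT_comp.
  exact: measurableT_comp.
move=> c.
apply: (@int_preserving_shear_snd R _ _ lam (fun=> phi c)); exact: measurable_cst.
Qed.

Lemma int_preserving_shear1 (phi : MR -> R) : measurable_fun setT phi ->
  int_preserving (@lebesgue3 R) (fun y => ((y.1.1 + phi y.2, y.1.2), y.2)).
Proof.
move=> mphi.
apply: (@int_preserving_shear_fst R _ _ (@lebesgue2 R)
  (fun c y => (y.1 + phi c, y.2))) => //.
  apply: measurable_fun_pair => //=; last exact: measurableT_comp.
  apply: measurable_funD => /=; first exact: measurableT_comp.
  exact: measurableT_comp.
move=> c.
apply: (@int_preserving_shear_fst R _ _ lam (fun _ x => x + phi c)).
  by apply: measurable_funD => //; exact: measurable_cst.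
by move=> _; exact: int_preserving_translation.
Qed.

Lemma int_preserving_ext (f g : MR3 -> MR3) : f =1 g ->
  int_preserving (@lebesgue3 R) f -> int_preserving (@lebesgue3 R) g.
Proof. by move/funext ->. Qed.

(** A plane rotation is the product of three shears, with factors -t, s and -t, where t = s / (1 +
    c) is the tangent of the half angle. The half turn c = -1 has no such t; it is the square of the
    quarter turn (c, s) = (0, 1). *)
Lemma int_preserving_rot1 (c s : R) : c ^+ 2 + s ^+ 2 = 1 ->
  int_preserving (@lebesgue3 R)
    (fun y => ((c * y.1.1 - s * y.2, y.1.2), s * y.1.1 + c * y.2)).
Proof.
wlog c1 : c s / c != -1 => [hw cs|].
  have [c1|c1] := eqVneq c (-1); last exact: hw.
  have s0 : s = 0 by apply/eqP; rewrite -sqrf_eq0; apply/eqP; nra.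
  have h01 : (0 : R) ^+ 2 + 1 ^+ 2 = 1 by ring.
  have n01 : (0 : R) != -1 by rewrite eq_sym oppr_eq0 oner_eq0.
  apply: int_preserving_ext
    (int_preserving_comp (hw 0 1 n01 h01) (hw 0 1 n01 h01)).
  by move=> [[a b] z] /=; rewrite c1 s0; congr (_, _, _); ring.
move=> cs.
have c10 : 1 + c != 0 by rewrite addrC addr_eq0.
pose t := s / (1 + c).
have h1 := int_preserving_shear1 (phi := fun z => - t * z) (mulrl_measurable _).
have h3 : int_preserving (@lebesgue3 R)
    (fun y => (y.1, y.2 + s * y.1.1)).
  apply: (int_preserving_shear3 (phi := fun y => s * y.1)).
  apply: measurable_funM => //; exact: measurable_fst.
apply: int_preserving_ext (int_preserving_comp h1 (int_preserving_comp h3 h1)).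
have e1 : s * t = 1 - c.
  rewrite /t; apply: (mulIf c10); rewrite mulrA divfK//.
  by nra.
have e2 : t * (1 + c) = s by rewrite /t divfK.
move=> [[a b] z] /=; congr (_, _, _).
  transitivity (a - 2 * t * z - s * t * a + s * t * t * z); first by ring.
  by rewrite e1 -e2; ring.
transitivity (s * a + z - s * t * z); first by ring.
by rewrite e1; ring.
Qed.

Lemma int_preserving_rot2 (c s : R) : c ^+ 2 + s ^+ 2 = 1 ->
  int_preserving (@lebesgue3 R)
    (fun y => ((y.1.1, c * y.1.2 - s * y.2), s * y.1.2 + c * y.2)).
Proof.
wlog c1 : c s / c != -1 => [hw cs|].
  have [c1|c1] := eqVneq c (-1); last exact: hw.
  have s0 : s = 0 by apply/eqP; rewrite -sqrf_eq0; apply/eqP; nra.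
  have h01 : (0 : R) ^+ 2 + 1 ^+ 2 = 1 by ring.
  have n01 : (0 : R) != -1 by rewrite eq_sym oppr_eq0 oner_eq0.
  apply: int_preserving_ext
    (int_preserving_comp (hw 0 1 n01 h01) (hw 0 1 n01 h01)).
  by move=> [[a b] z] /=; rewrite c1 s0; congr (_, _, _); ring.
move=> cs.
have c10 : 1 + c != 0 by rewrite addrC addr_eq0.
pose t := s / (1 + c).
have h1 := int_preserving_shear2 (phi := fun z => - t * z) (mulrl_measurable _).
have h3 : int_preserving (@lebesgue3 R)
    (fun y => (y.1, y.2 + s * y.1.2)).
  apply: (int_preserving_shear3 (phi := fun y => s * y.2)).
  apply: measurable_funM => //; exact: measurable_snd.
apply: int_preserving_ext (int_preserving_comp h1 (int_preserving_comp h3 h1)).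
have e1 : s * t = 1 - c.
  rewrite /t; apply: (mulIf c10); rewrite mulrA divfK//.
  by nra.
have e2 : t * (1 + c) = s by rewrite /t divfK.
move=> [[a b] z] /=; congr (_, _, _).
  transitivity (b - 2 * t * z - s * t * b + s * t * t * z); first by ring.
  by rewrite e1 -e2; ring.
transitivity (s * b + z - s * t * z); first by ring.
by rewrite e1; ring.
Qed.

End Iso.

(** * Euclidean distance on triples, and moving a pair of points to an axis *)

Section euclid.
Context (R : realType).
Local Notation MR := (measurableTypeR R).
Local Notation MR3 := ((MR * MR) * MR)%type.
Implicit Types x y z : R3 R.

Lemma edist3_ge0 x y : 0 <= edist x y.
Proof. exact: sqrtr_ge0. Qed.

Lemma edist3C x y : edist x y = edist y x.
Proof. by rewrite /edist; congr Num.sqrt; ring. Qed.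

Lemma edist3xx x : edist x x = 0.
Proof. by rewrite /edist !subrr expr0n/= !addr0 sqrtr0. Qed.

Lemma sqr_edist x y : edist x y ^+ 2 =
  (x.1.1 - y.1.1) ^+ 2 + (x.1.2 - y.1.2) ^+ 2 + (x.2 - y.2) ^+ 2.
Proof. by rewrite sqr_sqrtr// !addr_ge0// sqr_ge0. Qed.

Lemma edist3_eq0 x y : edist x y = 0 -> x = y.
Proof.
move=> h; have := sqr_edist x y; rewrite h expr0n/= => e.
have := sqr_ge0 (x.1.1 - y.1.1); have := sqr_ge0 (x.1.2 - y.1.2).
have := sqr_ge0 (x.2 - y.2) => h1 h2 h3.
have e1 : (x.1.1 - y.1.1) ^+ 2 = 0 by lra.
have e2 : (x.1.2 - y.1.2) ^+ 2 = 0 by lra.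
have e3 : (x.2 - y.2) ^+ 2 = 0 by lra.
move: e1 e2 e3 => /eqP; rewrite sqrf_eq0 subr_eq0 => /eqP e1.
move=> /eqP; rewrite sqrf_eq0 subr_eq0 => /eqP e2.
move=> /eqP; rewrite sqrf_eq0 subr_eq0 => /eqP e3.
by case: x y e1 e2 e3 {h e h1 h2 h3} => [[? ?] ?] [[? ?] ?]/= -> -> ->.
Qed.

Lemma edist3_gt0 x y : x <> y -> 0 < edist x y.
Proof.
move=> xy; rewrite lt_neqAle edist3_ge0 andbT; apply/eqP => h; apply: xy.
exact: edist3_eq0.
Qed.

Lemma edist3_triangle y x z : edist x z <= edist x y + edist y z.
Proof.
rewrite -(@ler_pXn2r _ 2)// ?nnegrE ?addr_ge0 ?edist3_ge0//.
have e1 := sqr_edist x y; have e2 := sqr_edist y z; rewrite sqr_edist.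
have p1 := edist3_ge0 x y; have p2 := edist3_ge0 y z.
set a := edist x y in e1 p1 *; set b := edist y z in e2 p2 *.
rewrite (sqrrD a b) e1 e2.
pose a1 := x.1.1 - y.1.1; pose a2 := x.1.2 - y.1.2; pose a3 := x.2 - y.2.
pose b1 := y.1.1 - z.1.1; pose b2 := y.1.2 - z.1.2; pose b3 := y.2 - z.2.
have -> : x.1.1 - z.1.1 = a1 + b1 by rewrite /a1 /b1; ring.
have -> : x.1.2 - z.1.2 = a2 + b2 by rewrite /a2 /b2; ring.
have -> : x.2 - z.2 = a3 + b3 by rewrite /a3 /b3; ring.
rewrite -/a1 -/a2 -/a3 -/b1 -/b2 -/b3 in e1 e2 *.
suff: a1 * b1 + a2 * b2 + a3 * b3 <= a * b by lra.
have [h|/ltW h] := leP (a1 * b1 + a2 * b2 + a3 * b3) 0.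
  by apply: (le_trans h); exact: mulr_ge0.
rewrite -(@ler_pXn2r _ 2)// ?nnegrE ?mulr_ge0// exprMn e1 e2.
have := sqr_ge0 (a1 * b2 - a2 * b1); have := sqr_ge0 (a1 * b3 - a3 * b1).
have := sqr_ge0 (a2 * b3 - a3 * b2); lra.
Qed.

Lemma measurable_edist_pair :
  measurable_fun setT (fun p : MR3 * MR3 => edist p.1 p.2 : MR).
Proof.
rewrite /edist.
apply: (measurableT_comp (f := @Num.sqrt R : MR -> MR)).
  exact: (continuous_measurable_fun (@sqrt_continuous R)).
have m1 : measurable_fun setT (fun p : MR3 * MR3 => p.1) := measurable_fst.
have m2 : measurable_fun setT (fun p : MR3 * MR3 => p.2) := measurable_snd.
have p11 : measurable_fun setT (fun p : MR3 => p.1.1).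
  exact: measurableT_comp measurable_fst measurable_fst.
have p12 : measurable_fun setT (fun p : MR3 => p.1.2).
  exact: measurableT_comp measurable_snd measurable_fst.
have p2 : measurable_fun setT (fun p : MR3 => p.2) := measurable_snd.
apply: measurable_funD; first apply: measurable_funD;
  apply: measurable_funX; apply: measurable_funB.
- exact: measurableT_comp p11 m1.
- exact: measurableT_comp p11 m2.
- exact: measurableT_comp p12 m1.
- exact: measurableT_comp p12 m2.
- exact: measurableT_comp p2 m1.
- exact: measurableT_comp p2 m2.
Qed.

Lemma measurable_edist (a : R3 R) :
  measurable_fun setT (fun y : MR3 => edist y a : MR).
Proof.
have m : measurable_fun setT (fun y : MR3 => (y, a : MR3)).
  exact: measurable_fun_pair.
exact: (measurableT_comp measurable_edist_pair m).
Qed.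

Lemma measurable_eball (a : R3 R) r : measurable (eball a r : set MR3).
Proof.
rewrite (_ : eball a r = (fun y : MR3 => edist y a : MR) @^-1` `]-oo, r[).
  by rewrite -[X in measurable X]setTI; exact: measurable_edist.
by apply/seteqP; split=> y /=; rewrite in_itv.
Qed.

(** Balls of the product topology are boxes in the largest coordinate difference, which never
    exceeds the Euclidean distance. *)
Lemma eball_sub_open (D : set (R3 R)) x : open D -> D x ->
  exists2 e : R, 0 < e & eball x e `<=` D.
Proof.
move=> oD Dx; have /nbhs_ballP[e /= e0 be] := open_nbhs_nbhs (conj oD Dx).
exists e => // y /= yx; apply: be.
have h : forall t u v : R, 0 <= u -> 0 <= v -> t ^+ 2 + u + v = edist y x ^+ 2 ->
  `|t| < e.
  move=> t u v u0 v0 E; apply: le_lt_trans yx.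
  rewrite -(@ler_pXn2r _ 2)// ?nnegrE ?edist3_ge0// real_normK ?num_real//.
  by rewrite -E -addrA lerDl addr_ge0.
have E := sqr_edist y x.
have b1 : `|x.1.1 - y.1.1| < e.
  apply: (h _ ((y.1.2 - x.1.2) ^+ 2) ((y.2 - x.2) ^+ 2)); rewrite ?sqr_ge0//.
  by rewrite E; ring.
have b2 : `|x.1.2 - y.1.2| < e.
  apply: (h _ ((y.1.1 - x.1.1) ^+ 2) ((y.2 - x.2) ^+ 2)); rewrite ?sqr_ge0//.
  by rewrite E; ring.
have b3 : `|x.2 - y.2| < e.
  apply: (h _ ((y.1.1 - x.1.1) ^+ 2) ((y.1.2 - x.1.2) ^+ 2)); rewrite ?sqr_ge0//.
  by rewrite E; ring.
exact: (conj (conj b1 b2) b3).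
Qed.

(** Euclidean balls are measurable for the product sigma-algebra, and an open set is the union of
    those with rational centre and radius 1 / (n + 1) that it contains, a countable family. *)
Lemma measurable_open3 (D : set (R3 R)) : open D -> measurable (D : set MR3).
Proof.
move=> oD.
pose I := (rat * rat * rat * nat)%type.
pose c (i : I) : R3 R := (ratr i.1.1.1, ratr i.1.1.2, ratr i.1.2).
pose e (i : I) : R := i.2.+1%:R^-1.
pose B (i : I) := if `[< eball (c i) (e i) `<=` D >] then eball (c i) (e i) else set0.
rewrite (_ : D = \bigcup_(i in [set: I]) B i); last first.
  apply/seteqP; split=> [x Dx|x [i _]]; last first.
    by rewrite /B; case: asboolP => // h /h.
  have [r r0 hr] := eball_sub_open oD Dx.
  have [n hn] : exists n : nat, n.+1%:R^-1 < r / 2.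
    have [n _ h] := near_infty_natSinv_lt (PosNum (divr_gt0 r0 (ltr0n R 2))).
    by exists n; exact: (h n (leqnn n)).
  have n0 : 0 < n.+1%:R^-1 :> R by rewrite invr_gt0 ltr0n.
  set k := n.+1%:R^-1 : R in hn n0.
  (* Coordinates within k / 2 give a squared distance below 3 k^2 / 4 < k^2. Two radii k still fit
     into r because k < r / 2. *)
  have hq (t : R) : exists q : rat, (t - ratr q) ^+ 2 < (k / 2) ^+ 2.
    have [|q] := @rat_in_itvoo R (t - k / 2) (t + k / 2); first by lra.
    by rewrite in_itv/= => /andP[h1 h2]; exists q; nra.
  have [q1 h1] := hq x.1.1; have [q2 h2] := hq x.1.2; have [q3 h3] := hq x.2.
  have xc : edist x (c (q1, q2, q3, n)) < k.
    rewrite -(@ltr_pXn2r _ 2)// ?nnegrE ?edist3_ge0 ?ltW// sqr_edist /=.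
    by nra.
  exists (q1, q2, q3, n) => //; rewrite /B; case: asboolP => [//|[]].
  move=> y /= yc; apply: hr => /=.
  apply: le_lt_trans (edist3_triangle (c (q1, q2, q3, n)) _ _) _.
  have yc' : edist y (c (q1, q2, q3, n)) < k := yc.
  by rewrite edist3C in xc; move: yc' xc hn; lra.
apply: countable_bigcupT_measurable => [|i]; first exact: countableP.
by rewrite /B; case: ifP => _ //; exact: measurable_eball.
Qed.

(** The signs match the rotation (a, z) to (c a - s z, s a + c z), which carries (0, m) to (u, v)
    when m is the norm of (u, v). *)
Lemma rotation_to_axis (u v : R) : exists c s : R,
  [/\ c ^+ 2 + s ^+ 2 = 1, - s * Num.sqrt (u ^+ 2 + v ^+ 2) = u
    & c * Num.sqrt (u ^+ 2 + v ^+ 2) = v].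
Proof.
set m := Num.sqrt _.
have m2 : m ^+ 2 = u ^+ 2 + v ^+ 2 by rewrite sqr_sqrtr// addr_ge0// sqr_ge0.
have [m0|m0] := eqVneq m 0.
  have := sqr_ge0 u; have := sqr_ge0 v; rewrite m0 expr0n/= in m2 => h1 h2.
  have /eqP : u ^+ 2 = 0 by lra.
  have /eqP : v ^+ 2 = 0 by lra.
  rewrite !sqrf_eq0 => /eqP-> /eqP->.
  by exists 1, 0; split; rewrite ?m0; ring.
exists (v / m), (- u / m); split; last 2 first.
- by rewrite -mulNr opprK divfK.
- by rewrite divfK.
rewrite !expr_div_n sqrrN -mulrDl addrC -m2 divff// sqrf_eq0//.
Qed.

(* Any pair of points is moved to the origin and the third axis by a
   translation and two plane rotations, all products of shears. *)
Lemma exists_isometry (x0 x : R3 R) : exists T : R3 R -> R3 R,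
  [/\ int_preserving (@lebesgue3 R) T, forall u v, edist (T u) (T v) = edist u v,
      T 0 = x0 & T (0, 0, edist x x0) = x].
Proof.
have [c1 [s1 [e1 h1 k1]]] := rotation_to_axis (x.1.1 - x0.1.1) (x.2 - x0.2).
set m := Num.sqrt _ in h1 k1.
have m2 : m ^+ 2 = (x.1.1 - x0.1.1) ^+ 2 + (x.2 - x0.2) ^+ 2.
  by rewrite sqr_sqrtr// addr_ge0// sqr_ge0.
have [c2 [s2 [e2]]] := rotation_to_axis (x.1.2 - x0.1.2) m.
rewrite m2 (_ : Num.sqrt _ = edist x x0) => [h2 k2|]; last first.
  by congr Num.sqrt; ring.
have e1' : s1 ^+ 2 = 1 - c1 ^+ 2 by rewrite -e1; ring.
have e2' : s2 ^+ 2 = 1 - c2 ^+ 2 by rewrite -e2; ring.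
pose t1 := int_preserving_shear1 (R := R) (phi := fun=> x0.1.1) (measurable_cst _).
pose t2 := int_preserving_shear2 (R := R) (phi := fun=> x0.1.2) (measurable_cst _).
pose t3 := int_preserving_shear3 (R := R) (phi := fun=> x0.2) (measurable_cst _).
pose r1 := int_preserving_rot1 e1.
pose r2 := int_preserving_rot2 e2.
pose T := int_preserving_comp t1 (int_preserving_comp t2 (int_preserving_comp t3
  (int_preserving_comp r1 r2))).
eexists; split; first exact: T.
- move=> u v; rewrite /edist/=; congr Num.sqrt.
  ring: e1' e2'.
- by case: x0 {h1 k1 m m2 h2 k2 t1 t2 t3 T} => [[a b] d] /=;
    congr (_, _, _); ring.
- move: h1 k1 h2 k2; case: x {m2} m => [[a b] d] m /=.
  case: x0 {t1 t2 t3 T} => [[a0 b0] d0]/= h1 k1 h2 k2.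
  congr (_, _, _).
  + rewrite -[RHS](subrK a0) -h1 -k2; ring.
  + rewrite -[RHS](subrK b0) -h2; ring.
  + rewrite -[RHS](subrK d0) -k1 -k2; ring.
Qed.

End euclid.

(** * Planar integrals of functions of the squared radius *)

Section radial.
Context (R : realType).
Local Notation lam := (@lebesgue_measure R).
Local Notation MR := (measurableTypeR R).
Local Open Scope ereal_scope.

Lemma ge0_integral_scale (k : R) (g : MR -> \bar R) : (0 < k)%R ->
  measurable_fun setT g -> (forall x, 0 <= g x) ->
  \int[lam]_x g x = k%:E * \int[lam]_x g (k * x)%R.
Proof.
move=> k0 mg g0; pose t : MR -> MR := fun x => (k * x)%R.
have mt : measurable_fun [set: MR] t by exact: mulrl_measurable.
rewrite -[X in _ = _ * X](_ : \int[pushforward lam t]_x g x = _); last first.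
  by rewrite ge0_integral_pushforward.
pose nk : {nonneg R} := NngNum (ltW k0).
rewrite -(ge0_integral_mscale (pushforward lam t) measurableT nk mg)//.
apply: eq_measure_integral => //= A mA _.
apply: lebesgue_measure_unique => // _ [[a b]] _ <- /=.
rewrite /mscale/= /pushforward.
rewrite (_ : _ @^-1` _ = `](a / k)%R, (b / k)%R]%classic); last first.
  apply/seteqP; split=> x /=; rewrite !in_itv/= /t.
    by rewrite ltr_pdivrMr// ler_pdivlMr// mulrC.
  by rewrite ltr_pdivrMr// ler_pdivlMr// mulrC.
rewrite !lebesgue_measure_itv/= !lte_fin ltr_pM2r ?invr_gt0//.
case: ifP => // _; last by rewrite mule0.
rewrite -!EFinB -EFinM -mulrBl; congr EFin.
by rewrite mulrC divfK// gt_eqF.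
Qed.

Definition sq2 (p : MR * MR) : MR := (p.1 ^+ 2 + p.2 ^+ 2)%R.

Lemma measurable_sq2 : measurable_fun setT sq2.
Proof.
apply: measurable_funD; apply: measurable_funX.
  exact: measurable_fst.
exact: measurable_snd.
Qed.

(** Indexed by the squared radius, so that the area is linear in [Q] for [Q] >= 0. *)
Definition disc (Q : R) : set (MR * MR) := [set p | (sq2 p <= Q)%R].

Lemma measurable_disc Q : measurable (disc Q).
Proof.
rewrite (_ : disc Q = sq2 @^-1` `]-oo, Q]).
  by rewrite -[X in measurable X]setTI; exact: measurable_sq2.
by apply/seteqP; split=> y /=; rewrite in_itv.
Qed.

Lemma lebesgue2_disc_le0 Q : (Q <= 0)%R -> @lebesgue2 R (disc Q) = 0.
Proof.
move=> Q0; apply/eqP; rewrite eq_le measure_ge0 andbT.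
apply: (@le_trans _ _ (@lebesgue2 R ([set 0%R] `*` [set 0%R]))).
  apply: le_measure; rewrite ?inE; [exact: measurable_disc|exact: measurableX|].
  move=> [a b]; rewrite /disc /sq2 /= => h.
  have h1 := sqr_ge0 a; have h2 := sqr_ge0 b.
  by split => /=; apply/eqP; rewrite -sqrf_eq0; apply/eqP; lra.
by rewrite /lebesgue2 product_measure1E//= lebesgue_measure_set1 mul0e.
Qed.

Lemma lebesgue2_disc_fin : @lebesgue2 R (disc 1) \is a fin_num.
Proof.
rewrite ge0_fin_numE//.
apply: (@le_lt_trans _ _ (@lebesgue2 R (`[(-1)%R, 1%R] `*` `[(-1)%R, 1%R]))).
  apply: le_measure; rewrite ?inE; [exact: measurable_disc|exact: measurableX|].
  move=> [a b]; rewrite /disc /sq2 /= => h.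
  by split => /=; rewrite in_itv/=; apply/andP; split; nra.
rewrite /lebesgue2 product_measure1E//= lebesgue_measure_itv/=.
by case: ifP => _; rewrite -?EFinB -?EFinM ?mul0e ltry.
Qed.

Definition disc_area : R := fine (@lebesgue2 R (disc 1)).

Lemma disc_area_gt0 : (0 < disc_area)%R.
Proof.
rewrite -lte_fin fineK ?lebesgue2_disc_fin//.
apply: (@lt_le_trans _ _ (@lebesgue2 R (`[0%R, (2^-1)%R] `*` `[0%R, (2^-1)%R]))).
  rewrite /lebesgue2 product_measure1E//= lebesgue_measure_itv/=.
  by rewrite lte_fin invr_gt0 ltr0n -EFinB -EFinM lte_fin subr0 mulr_gt0.
apply: le_measure; rewrite ?inE; [exact: measurableX|exact: measurable_disc|].
move=> [a b] [/=]; rewrite !in_itv/= => /andP[a0 a1] /andP[b0 b1].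
by rewrite /disc/sq2/=; nra.
Qed.

(** Scaling both coordinates by k = sqrt Q turns [disc Q] into [disc 1] and costs a factor k in each
    of the two iterated integrals. [Num.max] covers the null discs, those with [Q] <= 0. *)
Lemma lebesgue2_disc Q : @lebesgue2 R (disc Q) = (disc_area * Num.max Q 0)%:E.
Proof.
have [Q0|Q0] := leP Q 0%R; first by rewrite lebesgue2_disc_le0// mulr0.
pose k := Num.sqrt Q; have k0 : (0 < k)%R by rewrite sqrtr_gt0.
have k2 : (k ^+ 2 = Q)%R by rewrite sqr_sqrtr// ltW.
pose f (K : R) (p : MR * MR) : \bar R := (\1_(disc K) p)%:E.
have mf K : measurable_fun setT (f K).
  by apply/measurable_EFinP/measurable_indic; exact: measurable_disc.
have f0 K p : 0 <= f K p by rewrite lee_fin.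
have E K : @lebesgue2 R (disc K) = \int[lam]_x \int[lam]_y f K (x, y).
  rewrite -(fubini_tonelli1 (m1 := lam) (m2 := lam) (f K))// integral_indic//.
    by rewrite setIT.
  exact: measurable_disc.
rewrite /disc_area EFinM fineK ?lebesgue2_disc_fin// !E.
rewrite (ge0_integral_scale k0); last 2 first.
- exact: (measurable_fun_fubini_tonelli_F (m2 := lam) (f Q)).
- by move=> x; exact: integral_ge0.
transitivity (k%:E * \int[lam]_x (k%:E * \int[lam]_y f 1%R (x, y))).
  congr (_ * _); apply: eq_integral => x _.
  rewrite (ge0_integral_scale k0)//; last exact: measurableT_comp (mf Q) _.
  congr (_ * _); apply: eq_integral => y _.
  rewrite /f !indicE; congr ((_ _)%:R%:E); rewrite /disc /sq2; apply/idP/idP;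
    rewrite !inE/= !exprMn k2 -mulrDr.
    by rewrite -ler_pdivlMl// mulVf ?gt_eqF.
  by rewrite -ler_pdivlMl// mulVf ?gt_eqF.
rewrite ge0_integralZl//; last 3 first.
- exact: (measurable_fun_fubini_tonelli_F (m2 := lam) (f 1%R)).
- by move=> x _; exact: integral_ge0.
- by rewrite lee_fin ltW.
by rewrite muleA -EFinM -expr2 k2 muleC.
Qed.

(* The image of planar Lebesgue measure under [sq2] is [disc_area] times
   Lebesgue measure on the half-line; adding Lebesgue measure on the negative
   half-line turns this into an instance of the uniqueness theorem on [R]. *)
Lemma integral_radial2 (f : MR -> \bar R) :
  measurable_fun setT f -> (forall x, 0 <= f x) ->
  \int[@lebesgue2 R]_p f (sq2 p) =
  disc_area%:E * \int[lam]_(q in `]0%R, +oo[) f q.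
Proof.
move=> mf f0.
have c0 := disc_area_gt0.
pose k : {nonneg R} := NngNum (ltW (eq_ind _ is_true c0 _ (esym (invr_gt0 _)))).
have mneg : measurable (`]-oo, 0%R] : set MR) by exact: measurable_itv.
pose nu0 : {measure set MR -> \bar R} := pushforward (@lebesgue2 R) sq2.
pose nu := nu0 measurable_sq2.
pose m : {measure set MR -> \bar R} := measure_add (mscale k nu) (mrestr lam mneg).
have mD A : m A = (disc_area^-1)%:E * @lebesgue2 R (sq2 @^-1` A) +
    lam (A `&` `]-oo, 0%R]).
  exact: (measure_addE (mscale k nu) (mrestr lam mneg) A).
have mE A : measurable A -> lam A = m A.
  apply: lebesgue_measure_unique => // _ [[a b]] _ <- /=.
  rewrite mD/=.
  have [ba|ab] := leP b a.
    rewrite set_itv_ge ?bnd_simp -?leNgt// preimage_set0 set0I !measure0.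
    by rewrite mule0 adde0.
  rewrite (_ : _ @^-1` _ = disc b `\` disc a); last first.
    apply/seteqP; split=> p /=; rewrite in_itv/=.
      by move=> /andP[h1 h2]; split=> //; apply/negP; rewrite -ltNge.
    by move=> [h1 /negP]; rewrite -ltNge => h2; rewrite h2.
  rewrite measureD; [|exact: measurable_disc|exact: measurable_disc|]; last first.
    by rewrite /= lebesgue2_disc ltry.
  rewrite setIidr; last by move=> p /=; rewrite /disc/= => /le_trans; apply; exact: ltW.
  rewrite /= !lebesgue2_disc.
  rewrite (_ : _ `&` _ = `]a, (Num.min b 0)%R]%classic); last first.
    apply/seteqP; split=> x /=; rewrite !in_itv/= le_min.
      by move=> [/andP[-> ->] ->].
    by move=> /andP[-> /andP[-> ->]].
  rewrite !lebesgue_measure_itv/= !lte_fin ab -!EFinB -EFinM.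
  rewrite -mulrBr mulrA mulVf ?gt_eqF// mul1r.
  have [b0|b0] := leP b 0%R; have [a0|a0] := leP a 0%R.
  - by rewrite ab -EFinD; congr EFin; ring.
  - by exfalso; lra.
  - case: ltP => a00; first by rewrite -EFinD; congr EFin; ring.
    have -> : a = 0%R by lra.
    by rewrite adde0.
  - by rewrite ltNge (ltW a0)/= adde0.
have mS : measurable (`]0%R, +oo[ : set MR) by exact: measurable_itv.
have mp : measurable (sq2 @^-1` `]0%R, +oo[).
  by rewrite -[X in measurable X]setTI; exact: measurable_sq2.
transitivity (\int[@lebesgue2 R]_(p in sq2 @^-1` `]0%R, +oo[) f (sq2 p)).
  (* Only the null set [disc 0] is lost in passing to the open half-line. *)
  rewrite (ge0_negligible_integral (measurable_disc 0%R))//; last 2 first.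
  - exact: measurableT_comp mf measurable_sq2.
  - exact: lebesgue2_disc_le0.
  congr (integral _ _ _); apply/seteqP; split => p /=; rewrite in_itv/= andbT.
    by move=> [_ /negP]; rewrite -ltNge.
  by move=> h; split=> //; apply/negP; rewrite -ltNge.
rewrite (eq_measure_integral (mscale k nu)); last first.
  move=> A mA AS; transitivity (m A); first exact: mE.
  rewrite mD [X in _ + X](_ : _ = 0) ?adde0//.
  rewrite (_ : _ `&` _ = set0) ?measure0//.
  apply/seteqP; split=> x //= [/AS]; rewrite /= !in_itv/= andbT.
  by rewrite ltNge => /negP.
rewrite ge0_integral_mscale//; last exact: measurable_funS mf.
rewrite ge0_integral_pushforward//; last 2 first.
- exact: measurable_sq2.
- exact: measurable_funS mf.
by rewrite muleA -EFinM divff ?gt_eqF// mul1e.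
Qed.

End radial.

(** * Ball integrals of radial kernels by slicing *)

Section slices.
Context (R : realType).
Local Notation lam := (@lebesgue_measure R).
Local Notation MR := (measurableTypeR R).
Local Notation MR3 := ((MR * MR) * MR)%type.

Lemma is_derive_continuous (F : R -> R) (x l : R) :
  is_derive x 1 F l -> {for x, continuous F}.
Proof.
move=> dF; apply: differentiable_continuous; apply/derivable1_diffP.
exact: ex_derive.
Qed.

Lemma integral_is_derive (f F : R -> R) (a b : R) : a < b ->
  (forall x, a <= x <= b -> is_derive x 1 F (f x)) ->
  (forall x, a <= x <= b -> {for x, continuous f}) ->
  (\int[lam]_(x in `[a, b]) (f x)%:E = (F b - F a)%:E)%E.
Proof.
move=> ab dF cf; rewrite EFinB; apply: continuous_FTC2 => //.
- by apply: continuous_in_subspaceT => x; rewrite inE/= in_itv/=; exact: cf.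
- split.
  + move=> x; rewrite in_itv/= => /andP[/ltW ax /ltW xb].
    by have [] : is_derive x 1 F (f x) by apply: dF; rewrite ax.
  + apply: cvg_at_right_filter; apply: (is_derive_continuous (l := f a)).
    by apply: dF; rewrite lexx ltW.
  + apply: cvg_at_left_filter; apply: (is_derive_continuous (l := f b)).
    by apply: dF; rewrite lexx ltW.
- move=> x; rewrite in_itv/= => /andP[/ltW ax /ltW xb].
  rewrite derive1E; have h : is_derive x 1 F (f x) by apply: dF; rewrite ax.
  exact: derive_val.
Qed.

(** Inversion is not continuous at 0, so measurability is taken from [powR] with exponent -1, which
    agrees with it on nonnegative reals; at 0 both are 0. *)
Lemma measurable_inv_nneg (d : measure_display) (T : measurableType d)
    (f : T -> R) : measurable_fun setT f -> (forall x, 0 <= (f x : R)) ->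
  measurable_fun setT (fun x => (f x : R)^-1 : MR).
Proof.
move=> mf f0.
rewrite (_ : (fun x => _) = (fun x => f x `^ (-1))); last first.
  by apply/funext => x; rewrite powR_inv1.
exact: (measurableT_comp (measurable_powR (-1) : measurable_fun setT (fun t : MR => t `^ (-1) : MR)) mf).
Qed.

Variables (g G : R -> R).
Hypotheses (cg : continuous g) (g0 : forall t : R, 0 <= t -> 0 <= g t).
Hypothesis dG : forall t : R, is_derive t 1 G (g t).

Lemma is_derive_sqrtD (w q : R) : 0 < q + w ->
  is_derive q 1 (fun q => Num.sqrt (q + w)) (2 * Num.sqrt (q + w))^-1.
Proof.
move=> qw.
have h := @is_derive1_sqrt R (q + w) qw.
have h2 : is_derive q 1 (fun q : R => q + w) 1.
  by apply: is_derive_eq; rewrite addr0.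
have := @is_derive1_comp R (@Num.sqrt R) (fun q => q + w) q _ _ h h2.
by rewrite mulr1.
Qed.

(** In s = sqrt (q + w^2) one has dq = 2 s ds, which cancels the denominator and makes 2 G(s) an
    antiderivative. The condition on [w] keeps s away from 0, where the square root is not
    differentiable. *)
Lemma integral_slice (w Q : R) : w != 0 -> 0 < Q ->
  (\int[lam]_(q in `[0%R, Q])
     (g (Num.sqrt (q + w ^+ 2)) / Num.sqrt (q + w ^+ 2))%:E =
   (2 * (G (Num.sqrt (Q + w ^+ 2)) - G `|w|))%:E)%E.
Proof.
move=> w0 Q0.
have w2 : 0 < w ^+ 2 by rewrite exprn_even_gt0.
pose F q := 2 * G (Num.sqrt (q + w ^+ 2)).
transitivity ((F Q - F 0)%:E); last first.
  by rewrite /F add0r sqrtr_sqr mulrBr.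
apply: (integral_is_derive (f := fun q =>
  g (Num.sqrt (q + w ^+ 2)) / Num.sqrt (q + w ^+ 2))) => //.
- move=> q /andP[q0 _].
  have qw : 0 < q + w ^+ 2 by lra.
  have s0 : Num.sqrt (q + w ^+ 2) != 0 by rewrite gt_eqF// sqrtr_gt0.
  have := @is_derive1_comp R G _ q _ _ (dG _) (is_derive_sqrtD qw) => h.
  have h2 := is_deriveZ 2 h.
  apply: (is_derive_eq h2).
  by rewrite /GRing.scale/=; field.
- move=> q /andP[q0 _].
  have qw : 0 < q + w ^+ 2 by lra.
  have s0 : Num.sqrt (q + w ^+ 2) != 0 by rewrite gt_eqF// sqrtr_gt0.
  have cs := is_derive_continuous (is_derive_sqrtD qw).
  apply: cvgM; last exact: cvgV.
  by apply: continuous_comp; [exact: cs | exact: cg].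
Qed.

Let axis (d : R) : R3 R := (0, 0, d).

Lemma measurable_kernel (a : R3 R) :
  measurable_fun setT (fun y : MR3 => (g (edist y a) / edist y a)%:E).
Proof.
apply/measurable_EFinP; apply: measurable_funM.
  apply: (measurableT_comp (f := g : MR -> MR)); last exact: measurable_edist.
  exact: (continuous_measurable_fun cg).
apply: measurable_inv_nneg; first exact: measurable_edist.
by move=> y; exact: edist3_ge0.
Qed.

Lemma measurable_slice (r d : R) : measurable_fun setT (fun z : MR =>
  (2 * (G (Num.sqrt (r ^+ 2 + d ^+ 2 - 2 * d * z)) - G `|z - d|))%:E).
Proof.
apply/measurable_EFinP.
have mG : measurable_fun [set: MR] (G : MR -> MR).
  by apply: continuous_measurable_fun => t; exact: (is_derive_continuous (dG t)).
apply: measurable_funM => //; apply: measurable_funB.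
  apply: (measurableT_comp mG).
  apply: (measurableT_comp (f := @Num.sqrt R : MR -> MR)).
    exact: (continuous_measurable_fun (@sqrt_continuous R)).
  by apply: measurable_funB => //; exact: mulrl_measurable.
apply: (measurableT_comp mG); apply: measurableT_comp => //.
exact: measurable_funB.
Qed.

(** The slice of the ball at height z is a disc of squared radius r^2 - z^2. Across it the distance
    to the axis point runs from |z - d| at the centre to sqrt (r^2 + d^2 - 2 d z) at the rim, the
    two arguments of [G]. *)
Lemma integral_eball_axis (r d : R) : 0 < r ->
  (\int[@lebesgue3 R]_(y in eball (0 : R3 R)%R r)
     (g (edist y (axis d)) / edist y (axis d))%:E =
   (disc_area R)%:E * \int[lam]_(z in `](- r)%R, r[)
     (2 * (G (Num.sqrt (r ^+ 2 + d ^+ 2 - 2 * d * z)) - G `|z - d|))%:E)%E.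
Proof.
move=> r0.
(* The indicator of the ball is built into [phi], so that q runs over the whole half-line at every
   height, as in [integral_radial2]. *)
pose phi (z q : R) : R := (q + z ^+ 2 < r ^+ 2)%R%:R *
  (g (Num.sqrt (q + (z - d) ^+ 2)) / Num.sqrt (q + (z - d) ^+ 2)).
have phi0 z q : 0 <= phi z q.
  by rewrite mulr_ge0// ?ler0n// divr_ge0 ?g0 ?sqrtr_ge0.
have mphi z : measurable_fun [set: MR] (fun q : MR => (phi z q)%:E).
  apply/measurable_EFinP; apply: measurable_funM.
    rewrite (_ : (fun q : MR => _) = \1_(`]-oo, (r ^+ 2 - z ^+ 2)%R[%classic : set MR)).
      by apply: measurable_indic; exact: measurable_itv.
    apply/funext => q; rewrite indicE -ltrBrDr; case: ltP => h.
      by rewrite mem_set//= in_itv.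
    by rewrite memNset//= in_itv/=; apply/negP; rewrite -leNgt.
  have ms : measurable_fun [set: MR] (fun q : MR => Num.sqrt (q + (z - d) ^+ 2) : MR).
    apply: (measurableT_comp (f := @Num.sqrt R : MR -> MR)).
      exact: (continuous_measurable_fun (@sqrt_continuous R)).
    exact: measurable_funD.
  apply: measurable_funM; last by apply: measurable_inv_nneg => // ?; exact: sqrtr_ge0.
  apply: (measurableT_comp (f := g : MR -> MR)); last exact: ms.
  exact: (continuous_measurable_fun cg).
rewrite integral_mkcond.
set F := (_ \_ _).
have FE y : F y = (phi y.2 (sq2 y.1))%:E.
  rewrite /F patchE /phi.
  have e1 : edist y 0 ^+ 2 = sq2 y.1 + y.2 ^+ 2.
    by rewrite sqr_edist /sq2/= !subr0.
  have -> : edist y (axis d) = Num.sqrt (sq2 y.1 + (y.2 - d) ^+ 2).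
    by rewrite /Defs.edist /axis/= !subr0.
  rewrite -e1 ltr_pXn2r ?nnegrE ?edist3_ge0 ?ltW//.
  case: ifPn; first by rewrite inE /eball/= => ->; rewrite mul1r.
  by rewrite notin_setE /eball/= => /negP/negbTE->; rewrite mul0r.
have mF : measurable_fun setT F.
  apply/(measurable_restrictT _ _).1 => //; first exact: measurable_eball.
  exact: measurable_funS (measurable_kernel _).
have F0 y : (0 <= F y)%E by rewrite FE lee_fin.
rewrite [LHS](fubini_tonelli2 (m1 := @lebesgue2 R) (m2 := lam) F)// /fubini_G.
pose J (z : MR) : \bar R := (\int[lam]_(q in `]0%R, +oo[) (phi z q)%:E)%E.
have E1 z : (\int[@lebesgue2 R]_p F (p, z) = (disc_area R)%:E * J z)%E.
  rewrite -integral_radial2//; last by move=> q; rewrite lee_fin.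
  by apply: eq_integral => p _; rewrite FE.
(* Measurability is inherited from Tonelli's inner integral, from which [J] differs by the positive
   factor [disc_area]. *)
have mJ : measurable_fun setT J.
  have c0 := disc_area_gt0 R.
  have -> : J = (fun z => ((disc_area R)^-1)%:E * \int[@lebesgue2 R]_p F (p, z))%E.
    by apply/funext => z; rewrite E1 muleA -EFinM mulVf ?gt_eqF// mul1e.
  apply: measurable_funeM.
  exact: (measurable_fun_fubini_tonelli_G (m1 := @lebesgue2 R) F).
have J0 z : (0 <= J z)%E by apply: integral_ge0 => q _; rewrite lee_fin.
under eq_integral do rewrite E1.
rewrite ge0_integralZl//; last by rewrite lee_fin ltW// disc_area_gt0.
congr (_ * _)%E.
have Jout z : ~~ (- r < z < r) -> J z = 0%E.
  move=> zr; rewrite /J integral0_eq// => q; rewrite /= in_itv/= andbT => q0.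
  rewrite /phi [_ < _](_ : _ = false) ?mul0r//; apply/negbTE; rewrite -leNgt.
  by move: zr; rewrite negb_and -!leNgt => /orP[] h; nra.
have Jin z : - r < z < r -> z != d -> J z =
    (2 * (G (Num.sqrt (r ^+ 2 + d ^+ 2 - 2 * d * z)) - G `|z - d|))%:E.
  move=> /andP[z1 z2] zd; pose Q := r ^+ 2 - z ^+ 2.
  have Q0 : 0 < Q by rewrite /Q; nra.
  rewrite (_ : r ^+ 2 + _ - _ = Q + (z - d) ^+ 2); last by rewrite /Q; ring.
  rewrite -integral_slice ?subr_eq0//.
  rewrite (@integral_itv_bndoo _ 0 Q _ true false); last first.
    apply/measurable_funTS/measurable_EFinP.
    have ms : measurable_fun [set: MR] (fun q : MR => Num.sqrt (q + (z - d) ^+ 2) : MR).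
      apply: (measurableT_comp (f := @Num.sqrt R : MR -> MR)).
        exact: (continuous_measurable_fun (@sqrt_continuous R)).
      exact: measurable_funD.
    apply: measurable_funM; last by apply: measurable_inv_nneg => // ?; exact: sqrtr_ge0.
    apply: (measurableT_comp (f := g : MR -> MR)); last exact: ms.
    exact: (continuous_measurable_fun cg).
  rewrite /J integral_mkcond [RHS]integral_mkcond; apply: eq_integral => q _.
  rewrite !patchE /phi -ltrBrDr -/Q.
  have [q0|q0] := ltP 0 q; last first.
    by rewrite !ifF//; apply/negbTE; rewrite notin_setE/= in_itv/= ltNge q0.
  rewrite ifT; last by rewrite inE/= in_itv/= andbT.
  case: ltP => qQ; first by rewrite ifT ?mul1r// inE/= in_itv/= q0.
  rewrite ifF ?mul0r//; apply/negbTE.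
  by rewrite notin_setE/= in_itv/= q0/=; apply/negP; rewrite -leNgt.
transitivity (\int[lam]_(z in `](- r)%R, r[) J z)%E.
  rewrite [RHS]integral_mkcond; apply: eq_integral => z _.
  rewrite patchE; case: ifPn => //; rewrite notin_setE/= in_itv/= => /negP h.
  exact: Jout.
apply: ae_eq_integral => //.
- exact: measurable_funTS.
- by apply: measurable_funTS; exact: measurable_slice.
(* The slice formula is established only off the height z = d, which is a null set. *)
- exists [set d]; split => //; first exact: lebesgue_measure_set1.
  move=> z /= h; apply: contrapT => zd; apply: h; rewrite in_itv/= => zr.
  by apply: Jin => //; apply/eqP.
Qed.

Lemma integral_eball (x0 x : R3 R) (r : R) : 0 < r -> let d := edist x x0 in
  (\int[@lebesgue3 R]_(y in eball x0 r) (g (edist y x) / edist y x)%:E =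
   (disc_area R)%:E * \int[lam]_(z in `](- r)%R, r[)
     (2 * (G (Num.sqrt (r ^+ 2 + d ^+ 2 - 2 * d * z)) - G `|z - d|))%:E)%E.
Proof.
move=> r0 d; rewrite -integral_eball_axis// integral_mkcond.
have [T [[_ pT] isoT T0 Td]] := exists_isometry x0 x.
rewrite -[LHS]pT; last 2 first.
- apply/(measurable_restrictT _ _).1 => //; first exact: measurable_eball.
  exact: measurable_funS (measurable_kernel _).
- move=> y; rewrite patchE; case: ifP => // _.
  by rewrite lee_fin divr_ge0 ?g0 ?edist3_ge0.
rewrite [RHS]integral_mkcond; apply: eq_integral => u _; rewrite !patchE.
have h1 : edist (T u) x0 = edist u 0 by rewrite -T0 isoT.
have h2 : edist (T u) x = edist u (axis d) by rewrite -[x in LHS]Td isoT.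
by rewrite h2; congr (if _ then _ else _); apply/idP/idP;
  rewrite !inE /eball/= h1.
Qed.

End slices.

(** * Volume, Yukawa potential and [sinhc] integral of a ball *)

Section balls.
Context (R : realType).
Local Notation lam := (@lebesgue_measure R).
Local Notation MR := (measurableTypeR R).
Local Notation c := (disc_area R).

Lemma is_derive_expRM (k x : R) :
  is_derive x 1 (fun t => expR (k * t)) (k * expR (k * x)).
Proof.
have h : is_derive x 1 (fun t : R => k * t) k.
  by have := is_deriveZ k (is_derive_id x (1 : R)); rewrite /GRing.scale/= mulr1.
have := @is_derive1_comp R (@expR R) _ x _ _ (is_derive_expR _) h.
by rewrite mulrC.
Qed.

Lemma continuous_expRM (k : R) : continuous (fun t : R => expR (k * t)).
Proof. by move=> x; exact: (is_derive_continuous (is_derive_expRM k x)). Qed.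

Lemma leb3_eball (x0 : R3 R) (r : R) : 0 < r ->
  @lebesgue3 R (eball x0 r) = (c * (4 / 3 * r ^+ 3))%:E.
Proof.
(* With g t = t the kernel t / t is 1 except at [x], where 0 / 0 is 0. Placing [x] on the bounding
   sphere keeps that point out of the open ball, so the integral is the volume. *)
move=> r0; pose x : R3 R := (x0.1, x0.2 + r).
have dx : edist x x0 = r.
  rewrite /Defs.edist/= !subrr expr0n/= !add0r.
  by rewrite (_ : x0.2 + r - x0.2 = r) ?sqrtr_sqr ?gtr0_norm//; ring.
have dG (t : R) : is_derive t 1 (fun t => t ^+ 2 / 2) t.
  by apply: is_derive_eq; rewrite /GRing.scale/=; field.
have cg : continuous (fun t : R => t) by move=> t.
have := @integral_eball R (fun t => t) (fun t => t ^+ 2 / 2) cg (fun t h => h)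
  dG x0 x r r0; rewrite dx.
under eq_integral => y.
  rewrite inE /eball/= => yr; rewrite divff; last first.
    apply/eqP => /edist3_eq0 yx; move: yr; rewrite yx dx ltxx//.
  over.
rewrite /= integral_cst; last exact: measurable_eball.
rewrite mul1e => ->; rewrite EFinM; congr (_ * _)%E.
rewrite -(@integral_itv_bndoo _ (- r) r _ true false); last first.
  by apply: measurable_funTS; exact: (measurable_slice dG).
transitivity (\int[lam]_(z in `[(- r)%R, r]) (r ^+ 2 - z ^+ 2)%:E)%E.
  apply: eq_integral => z; rewrite inE/= in_itv/= => /andP[h1 h2].
  congr EFin; rewrite sqr_sqrtr; last first.
    by have := sqr_ge0 (z - r); nra.
  by rewrite real_normK ?num_real//; field.
pose F (z : R) := r ^+ 2 * z - z ^+ 3 / 3.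
transitivity ((F r - F (- r))%:E); last by rewrite /F; congr EFin; field.
apply: (integral_is_derive (f := fun z => r ^+ 2 - z ^+ 2)); first by lra.
  by move=> z _; apply: is_derive_eq; rewrite /GRing.scale/=; field.
move=> z _; apply: cvgB; first exact: cvg_cst.
exact: exprn_continuous.
Qed.

(** Serves integrands with a kink at [m], such as those containing |z - d|: each side has its own
    antiderivative. *)
Lemma integral_split (f f1 f2 F1 F2 : R -> R) (a m b : R) : a < m -> m < b ->
  measurable_fun [set: MR] (fun z : MR => (f z)%:E) ->
  (forall z : R, a <= z <= m -> f z = f1 z) -> (forall z : R, m <= z <= b -> f z = f2 z) ->
  (forall z : R, a <= z <= m -> is_derive z 1 F1 (f1 z)) ->
  (forall z : R, m <= z <= b -> is_derive z 1 F2 (f2 z)) ->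
  (forall z : R, a <= z <= m -> {for z, continuous f1}) ->
  (forall z : R, m <= z <= b -> {for z, continuous f2}) ->
  (\int[lam]_(z in `]a, b[) (f z)%:E = (F1 m - F1 a + (F2 b - F2 m))%:E)%E.
Proof.
move=> am mb mf e1 e2 d1 d2 c1 c2.
rewrite (@itv_bndbnd_setU _ _ (BRight a) (BLeft m) (BLeft b)) ?bnd_simp ?ltW//.
rewrite integral_setU//; last 2 first.
- exact: measurable_funTS.
- apply/disj_setPS => z /= []; rewrite !in_itv/= => /andP[_ h1] /andP[h2 _].
  by move: (lt_le_trans h1 h2); rewrite ltxx.
rewrite -(@integral_itv_bndoo _ a m _ true false); last exact: measurable_funTS.
rewrite (@integral_itv_bndoo _ m b _ true true); last exact: measurable_funTS.
rewrite -(@integral_itv_bndoo _ m b _ true false); last exact: measurable_funTS.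
rewrite EFinD -(integral_is_derive am d1 c1) -(integral_is_derive mb d2 c2).
congr (_ + _)%E; apply: eq_integral => z; rewrite inE/= in_itv/= => h.
  by rewrite e1.
by rewrite e2.
Qed.

(** This is sinh t / t, continued by its limit at 0. As a function of y, [sinhc (mu * edist y x0)]
    is the radial solution of the modified Helmholtz equation that is regular at [x0]. *)
Definition sinhc (t : R) : R := if t == 0 then 1 else (expR t - expR (- t)) / (2 * t).

(** Meant for d < r. The constant 4 c / mu^2 is the particular solution for a uniform source, and
    the [sinhc] term is the homogeneous correction. *)
Definition ball_potential (mu r d : R) : R :=
  4 * c / mu ^+ 2 * (1 - (1 + mu * r) * expR (- (mu * r)) * sinhc (mu * d)).

Lemma is_derive_sqrt_slice (r d z : R) : 0 <= d < r -> - r <= z <= r ->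
  is_derive z 1 (fun z => Num.sqrt (r ^+ 2 + d ^+ 2 - 2 * d * z))
    (- d / Num.sqrt (r ^+ 2 + d ^+ 2 - 2 * d * z)).
Proof.
move=> /andP[d0 dr] /andP[z1 z2].
have p : 0 < r ^+ 2 + d ^+ 2 - 2 * d * z by nra.
have h : is_derive z 1 (fun z : R => r ^+ 2 + d ^+ 2 - 2 * d * z) (- (2 * d)).
  by apply: is_derive_eq; rewrite /GRing.scale/=; ring.
have := @is_derive1_comp R (@Num.sqrt R) _ z _ _ (is_derive1_sqrt p) h.
move=> k; apply: (is_derive_eq k).
have s0 : Num.sqrt (r ^+ 2 + d ^+ 2 - 2 * d * z) != 0 by rewrite gt_eqF// sqrtr_gt0.
by field.
Qed.

(** The antiderivative [H] of the rim term is left abstract because its formula divides by [d] and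
    takes another form at the centre. *)
Lemma ball_potential_antiderivative (mu r d : R) (H : R -> R) :
  0 < mu -> 0 < r -> 0 <= d < r ->
  (forall z : R, - r <= z <= r -> is_derive z 1 H
     (expR (- mu * Num.sqrt (r ^+ 2 + d ^+ 2 - 2 * d * z)))) ->
  (\int[lam]_(z in `](- r)%R, r[)
    (2 * (- expR (- mu * Num.sqrt (r ^+ 2 + d ^+ 2 - 2 * d * z)) / mu
        - - expR (- mu * `|z - d|) / mu))%:E =
   (2 / mu * ((2 - expR (- mu * (r + d)) - expR (- mu * (r - d))) / mu
       - (H r - H (- r))))%:E)%E.
Proof.
move=> mu0 r0 /andP[d0 dr] dH.
have muN0 : mu != 0 by rewrite gt_eqF.
pose E (z : R) := expR (- mu * Num.sqrt (r ^+ 2 + d ^+ 2 - 2 * d * z)).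
have cE (z : R) : - r <= z <= r -> {for z, continuous E}.
  move=> zr.
  have k := is_derive_sqrt_slice (introT andP (conj d0 dr)) zr.
  apply: (@continuous_comp _ _ _ (fun z => Num.sqrt (r ^+ 2 + d ^+ 2 - 2 * d * z))
    (fun t => expR (- mu * t))); first exact: (is_derive_continuous k).
  exact: continuous_expRM.
have dP (k a z : R) : is_derive z 1 (fun z : R => expR (k * (z - a))) (k * expR (k * (z - a))).
  have h : is_derive z 1 (fun z : R => z - a) 1.
    by apply: is_derive_eq; rewrite subr0.
  have := @is_derive1_comp R (fun t => expR (k * t)) _ z _ _ (is_derive_expRM k _) h.
  by rewrite mulr1.
pose f1 (z : R) := 2 / mu * (expR (mu * (z - d)) - E z).
pose f2 (z : R) := 2 / mu * (expR (- mu * (z - d)) - E z).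
pose F1 (z : R) := 2 / mu * (expR (mu * (z - d)) / mu - H z).
pose F2 (z : R) := 2 / mu * (- expR (- mu * (z - d)) / mu - H z).
have dG (t : R) : is_derive t 1 (fun t => - expR (- mu * t) / mu) (expR (- mu * t)).
  have h := is_derive_expRM (- mu) t.
  by apply: is_derive_eq; rewrite /GRing.scale/=; field.
have hf1 (z : R) : - r <= z <= d -> - r <= z <= r by lra.
have hf2 (z : R) : d <= z <= r -> - r <= z <= r by lra.
transitivity ((F1 d - F1 (- r) + (F2 r - F2 d))%:E); last first.
  congr EFin; rewrite /F1 /F2 subrr !mulr0 expR0.
  by rewrite (_ : mu * (- r - d) = - mu * (r + d)); [field|ring].
apply: (@integral_split (fun z => 2 * (- expR (- mu * Num.sqrt
  (r ^+ 2 + d ^+ 2 - 2 * d * z)) / mu - - expR (- mu * `|z - d|) / mu)) f1 f2 F1 F2).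
- by lra.
- by [].
- exact: (measurable_slice dG).
- move=> z zr; rewrite ler0_norm; last by lra.
  by rewrite /f1 -/(E z) mulrNN; field.
- move=> z zr; rewrite ger0_norm; last by lra.
  by rewrite /f2 -/(E z); field.
- move=> z /hf1 zr; have h1 := dP mu d z; have h2 := dH z zr.
  by apply: is_derive_eq; rewrite /GRing.scale/= /f1 /E; field.
- move=> z /hf2 zr; have h1 := dP (- mu) d z; have h2 := dH z zr.
  by apply: is_derive_eq; rewrite /GRing.scale/= /f2 /E; field.
- move=> z /hf1 zr; apply: cvgM; first exact: cvg_cst.
  by apply: cvgB; [exact: (is_derive_continuous (dP mu d z))|exact: cE].
- move=> z /hf2 zr; apply: cvgM; first exact: cvg_cst.
  by apply: cvgB; [exact: (is_derive_continuous (dP (- mu) d z))|exact: cE].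
Qed.

Lemma ball_potentialE (mu r : R) (x0 x : R3 R) : 0 < mu -> edist x x0 < r ->
  (\int[@lebesgue3 R]_(y in eball x0 r) (Eminus mu y x)%:E =
   (ball_potential mu r (edist x x0))%:E)%E.
Proof.
move=> mu0 dr; have d0 := edist3_ge0 x x0.
have r0 : 0 < r by exact: le_lt_trans dr.
have muN0 : mu != 0 by rewrite gt_eqF.
have dG (t : R) : is_derive t 1 (fun t => - expR (- mu * t) / mu) (expR (- mu * t)).
  have h := is_derive_expRM (- mu) t.
  by apply: is_derive_eq; rewrite /GRing.scale/=; field.
have g0 (t : R) : 0 <= t -> 0 <= expR (- mu * t) by rewrite expR_ge0.
have := @integral_eball R (fun t => expR (- mu * t)) (fun t => - expR (- mu * t) / mu)
  (continuous_expRM (k := - mu)) g0 dG x0 x r r0.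
under eq_integral do rewrite mulNr.
move=> /= ->.
move: d0 dr; set d := edist x x0 => d0 dr.
rewrite /ball_potential /sinhc mulf_eq0 (negbTE muN0)/=.
have dr0 : 0 <= d < r by rewrite d0.
have [dz|dN0] := eqVneq d 0.
  (* At the centre the rim distance is constantly r, so the antiderivative is linear in z. *)
  have dH (z : R) : - r <= z <= r -> is_derive z 1 (fun z : R => z * expR (- mu * r))
      (expR (- mu * Num.sqrt (r ^+ 2 + d ^+ 2 - 2 * d * z))).
    move=> _; rewrite dz expr0n/= addr0 mulr0 mul0r subr0.
    rewrite sqrtr_sqr gtr0_norm//.
    by apply: is_derive_eq; rewrite /GRing.scale/=; ring.
  rewrite (ball_potential_antiderivative mu0 r0 dr0 dH).
  by rewrite -EFinM; congr EFin; rewrite dz addr0 subr0 mulNr; field.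
(* With s the rim distance, ds/dz = - d / s, so [P] has to be an antiderivative of - s exp (- mu s)
   / d. *)
pose P (t : R) := d^-1 * ((t / mu + (mu ^+ 2)^-1) * expR (- mu * t)).
have dP (t : R) : is_derive t 1 P (- t * expR (- mu * t) / d).
  have h := is_derive_expRM (- mu) t.
  by apply: is_derive_eq; rewrite /GRing.scale/=; field; rewrite muN0 dN0.
have dH (z : R) : - r <= z <= r ->
    is_derive z 1 (fun z => P (Num.sqrt (r ^+ 2 + d ^+ 2 - 2 * d * z)))
      (expR (- mu * Num.sqrt (r ^+ 2 + d ^+ 2 - 2 * d * z))).
  move=> zr.
  have k := is_derive_sqrt_slice dr0 zr.
  have := @is_derive1_comp R P _ z _ _ (dP _) k => kk.
  apply: (is_derive_eq kk).
  have s0 : Num.sqrt (r ^+ 2 + d ^+ 2 - 2 * d * z) != 0.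
    by rewrite gt_eqF// sqrtr_gt0; move: zr; nra.
  by field; rewrite s0 dN0.
rewrite (ball_potential_antiderivative mu0 r0 dr0 dH).
rewrite (_ : r ^+ 2 + d ^+ 2 - 2 * d * r = (r - d) ^+ 2); last by ring.
rewrite (_ : r ^+ 2 + d ^+ 2 - 2 * d * - r = (r + d) ^+ 2); last by ring.
rewrite !sqrtr_sqr !ger0_norm; [|lra|lra].
rewrite -EFinM; congr EFin; rewrite /P.
rewrite (_ : - mu * (r + d) = - (mu * r) + - (mu * d)); last by ring.
rewrite (_ : - mu * (r - d) = - (mu * r) + mu * d); last by ring.
rewrite !expRD.
by field; rewrite muN0 dN0.
Qed.

(** The kernel has g t = sinh (mu t) / mu, and both centres are [x0]. The integrand is
    [sinhc (mu * edist y x0)] off the centre and 0 there, since division by 0 gives 0. *)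
Lemma integral_eball_sinhc (mu r : R) (x0 : R3 R) : 0 < mu -> 0 < r ->
  (\int[@lebesgue3 R]_(y in eball x0 r)
     ((expR (mu * edist y x0) - expR (- mu * edist y x0)) / (2 * mu) / edist y x0)%:E =
   (2 * c / mu ^+ 3 * ((mu * r - 1) * expR (mu * r) + (mu * r + 1) * expR (- mu * r)))%:E)%E.
Proof.
move=> mu0 r0; have muN0 : mu != 0 by rewrite gt_eqF.
pose g (t : R) := (expR (mu * t) - expR (- mu * t)) / (2 * mu).
pose G (t : R) := (expR (mu * t) + expR (- mu * t)) / (2 * mu ^+ 2).
have dexp (k t : R) := is_derive_expRM k t.
have dG (t : R) : is_derive t 1 G (g t).
  have h1 := dexp mu t; have h2 := dexp (- mu) t.
  by apply: is_derive_eq; rewrite /GRing.scale/= /g; field.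
have dg (t : R) : is_derive t 1 g ((expR (mu * t) + expR (- mu * t)) / 2).
  have h1 := dexp mu t; have h2 := dexp (- mu) t.
  by apply: is_derive_eq; rewrite /GRing.scale/=; field.
have cg : continuous g by move=> t; exact: (is_derive_continuous (dg t)).
have g0 (t : R) : 0 <= t -> 0 <= g t.
  move=> t0; rewrite divr_ge0 ?mulr_ge0// ?(ltW mu0)// subr_ge0 ler_expR.
  by rewrite mulNr; have := mulr_ge0 (ltW mu0) t0; lra.
have := @integral_eball R g G cg g0 dG x0 x0 r r0; rewrite edist3xx => /= ->.
rewrite -(@integral_itv_bndoo _ (- r) r _ true false); last first.
  by apply: measurable_funTS; exact: (measurable_slice dG).
pose F (z : R) := 2 * (G r * z - (expR (mu * z) - expR (- mu * z)) / (2 * mu ^+ 3)).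
transitivity (c%:E * (F r - F (- r))%:E)%E; last first.
  rewrite -EFinM; congr EFin; rewrite /F /G.
  rewrite (_ : - mu * - r = mu * r); last by ring.
  rewrite (_ : mu * - r = - mu * r); last by ring.
  by field.
congr (_ * _)%E.
have rr : - r < r by lra.
have dF (z : R) : - r <= z <= r -> is_derive z 1 F (2 * (G r - G z)).
  move=> _; have h1 := dexp mu z; have h2 := dexp (- mu) z.
  by apply: is_derive_eq; rewrite /GRing.scale/= /G; field.
rewrite -(integral_is_derive rr dF).
  apply: eq_integral => z _; congr EFin; congr (_ * _).
  rewrite expr0n/= addr0 mulr0 mul0r !subr0 sqrtr_sqr gtr0_norm//.
  congr (_ - _); rewrite /G; have [z0|z0] := leP 0 z.
    by rewrite ger0_norm.
  by rewrite ltr0_norm// mulrNN mulrN -mulNr addrC.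
move=> z _; apply: cvgM; first exact: cvg_cst.
by apply: cvgB; [exact: cvg_cst|exact: (is_derive_continuous (dG z))].
Qed.

End balls.

(** * Closed form of the Bessel factor *)

Section bessel.
Context (R : realType).
Local Notation lam := (@lebesgue_measure R).
Local Notation MR := (measurableTypeR R).

(* The integrand of [Gamma (k + 5 / 2)], written without real powers so that
   it is continuous on the whole line. *)
Let gam (k : nat) (t : R) : R := t ^+ k.+1 * Num.sqrt t * expR (- t).

Let gam_ge0 k t : 0 <= t -> 0 <= gam k t.
Proof. by move=> t0; rewrite !mulr_ge0 ?exprn_ge0 ?sqrtr_ge0 ?expR_ge0. Qed.

Let continuous_gam k : continuous (gam k).
Proof.
move=> t; apply: cvgM; first apply: cvgM.
- exact: exprn_continuous.
- exact: sqrt_continuous.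
- apply: (@continuous_comp _ _ _ (fun t : R => - t) expR).
    exact: opp_continuous.
  exact: continuous_expR.
Qed.

Let gam_le k : exists2 C : R, 0 < C &
  forall t, 0 <= t -> gam k t <= C * expR (- (t / 2)).
Proof.
(* exp (t / 4) dominates (t / 4)^(k + 1) / (k + 1)! and also 1 + t / 4 >= sqrt t; together they use
   up only half of the decay of exp (- t). *)
exists (4 ^+ k.+1 * k.+1`!%:R).
  by rewrite mulr_gt0 ?exprn_gt0// ltr0n fact_gt0.
move=> t t0; rewrite /gam.
have -> : expR (- (t / 2)) = expR (t / 4) * expR (t / 4) * expR (- t).
  by rewrite -!expRD; congr expR; field.
rewrite mulrA ler_pM2r ?expR_gt0// mulrA ler_pM ?exprn_ge0 ?sqrtr_ge0//.
  have := @expR_ge1Dxn R (t / 4) k (divr_ge0 t0 (ler0n _ 4)).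
  rewrite exprMn exprVn => h.
  have f0 : 0 < k.+1`!%:R :> R by rewrite ltr0n fact_gt0.
  have p0 : 0 < 4 ^+ k.+1 :> R by rewrite exprn_gt0.
  have {}h : t ^+ k.+1 / 4 ^+ k.+1 / k.+1`!%:R <= expR (t / 4) by lra.
  by move: h; rewrite ler_pdivrMr// ler_pdivrMr// => h; nra.
apply: le_trans (expR_ge1Dx _).
have := sqr_sqrtr t0; have := sqrtr_ge0 t.
set s := Num.sqrt t => s0 s2; have := sqr_ge0 (s - 2); nra.
Qed.

Let cvg_expR_half : expR (- (t / 2)) @[t --> (+oo : set_system R)] --> (0 : R).
Proof.
apply: (@cvg_comp _ _ _ (fun t : R => t / 2) (fun t => expR (- t)) _ +oo).
  by apply: gt0_cvgMly.
exact: cvgr_expR.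
Qed.

Let cvg_gam k : gam k t @[t --> +oo] --> 0.
Proof.
have [C C0 hC] := gam_le k.
apply: (@squeeze_cvgr _ _ _ _ (fun=> 0) (fun t => C * expR (- (t / 2)))).
- near=> t; rewrite gam_ge0//= ?hC//; near: t; apply: nbhs_pinfty_ge; exact: num_real.
- exact: cvg_cst.
- rewrite -[X in _ --> X](mulr0 C); apply: cvgM; first exact: cvg_cst.
  exact: cvg_expR_half.
Unshelve. all: by end_near. Qed.

Let ray : set MR := `[0, +oo[%classic.

Let measurable_ray : measurable (ray : set MR).
Proof. exact: measurable_itv. Qed.

Let measurable_gam k : measurable_fun ray (EFin \o gam k).
Proof.
apply/measurable_funTS/measurable_EFinP.
exact: (continuous_measurable_fun (continuous_gam (k := k))).
Qed.

Let integrable_gam k : lam.-integrable ray (EFin \o gam k).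
Proof.
have [C C0 hC] := gam_le k.
have cexp : continuous (fun t : R => C * expR (- (t / 2))).
  have -> : (fun t : R => C * expR (- (t / 2))) = (fun t => C * expR (- 2^-1 * t)).
    by apply/funext => u; congr (_ * expR _); ring.
  move=> t; have h := is_derive_expRM (- 2^-1) t.
  exact: (is_derive_continuous (is_deriveZ C h)).
have mexp : measurable_fun [set: MR] (fun t : MR => C * expR (- (t / 2)) : MR).
  exact: (continuous_measurable_fun cexp).
apply/integrableP; split; first exact: measurable_gam.
apply: (@le_lt_trans _ _ (\int[lam]_(t in ray) (C * expR (- (t / 2)))%:E)%E).
  apply: ge0_le_integral => //.
  - by apply: measurableT_comp => //; exact: measurable_gam.
  - exact/measurable_funTS/measurable_EFinP.
  - move=> t; rewrite /ray/= in_itv/= andbT => t0.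
    by rewrite lee_fin ger0_norm ?gam_ge0// hC.
have dF (t : R) : is_derive t 1 (fun t => - (2 * C) * expR (- 2^-1 * t)) (C * expR (- (t / 2))).
  have h := is_derive_expRM (- 2^-1) t.
  apply: is_derive_eq; rewrite /GRing.scale/= (_ : - 2^-1 * t = - (t / 2)); last by ring.
  by field.
rewrite (@ge0_continuous_FTC2y _ _ (fun t => - (2 * C) * expR (- 2^-1 * t)) 0 0).
- by rewrite -EFinB ltry.
- by move=> t _; rewrite mulr_ge0 ?expR_ge0// ltW.
- exact: continuous_subspaceT.
- rewrite -[X in _ --> X](mulr0 (- (2 * C))); apply: cvgM; first exact: cvg_cst.
  rewrite (_ : (fun t => expR _) = (fun t : R => expR (- (t / 2)))); last first.
    by apply/funext => u; congr expR; ring.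
  exact: cvg_expR_half.
- by move=> t _; apply: ex_derive.
- by apply: cvg_at_right_filter; exact: (is_derive_continuous (dF 0)).
- by move=> t _; rewrite derive1E; exact: derive_val.
Qed.

Let Igam k : \bar R := (\int[lam]_(t in ray) (gam k t)%:E)%E.

Let Igam_fin k : Igam k \is a fin_num.
Proof. exact: integrable_fin_num (integrable_gam k). Qed.

Lemma is_derive_exprn n (t : R) :
  is_derive t 1 (fun t : R => t ^+ n.+1) (n.+1%:R * t ^+ n).
Proof.
elim: n => [|n ih].
  rewrite (_ : (fun t : R => t ^+ 1) = id) ?expr0 ?mulr1; first exact: is_derive_id.
  by apply/funext => u; rewrite expr1.
rewrite (_ : (fun t : R => t ^+ n.+2) = (fun t => t * t ^+ n.+1)); last first.
  by apply/funext => u; rewrite exprS.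
have h := is_deriveM (is_derive_id t (1 : R)) ih.
apply: (is_derive_eq h); rewrite /GRing.scale/= -!natr1 !exprS; ring.
Qed.

Let is_derive_gam k (t : R) : 0 < t ->
  is_derive t 1 (fun t => - gam k.+1 t) (gam k.+1 t - (k%:R + 5 / 2) * gam k t).
Proof.
move=> t0.
have h1 := is_derive1_sqrt t0.
have h2 : is_derive t 1 (fun t : R => expR (- t)) (- expR (- t)).
  have := is_derive_expRM (-1) t; rewrite !mulN1r.
  by under eq_fun do rewrite mulN1r.
have s0 : Num.sqrt t != 0 by rewrite gt_eqF// sqrtr_gt0.
have hX : is_derive t 1 (fun t : R => t ^+ k.+2) (k.+2%:R * t ^+ k.+1).
  exact: is_derive_exprn.
have hall := is_deriveN (is_deriveM (is_deriveM hX h1) h2).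
apply: (is_derive_eq hall); rewrite /gam.
change (- ((t ^+ k.+2 * Num.sqrt t) * - expR (- t) + expR (- t) *
    (t ^+ k.+2 * (2 * Num.sqrt t)^-1 + Num.sqrt t * (k.+2%:R * t ^+ k.+1))) =
  t ^+ k.+2 * Num.sqrt t * expR (- t)
  - (k%:R + 5 / 2) * (t ^+ k.+1 * Num.sqrt t * expR (- t))).
have e : t = Num.sqrt t ^+ 2 by rewrite sqr_sqrtr// ltW.
set s := Num.sqrt t in s0 e h1 *.
clear h1 h2 hX hall; clearbody s; subst t; rewrite !(exprS (s ^+ 2)).
rewrite -[k.+2%:R]natr1 -[k.+1%:R]natr1.
set a := (s ^+ 2) ^+ k.
by field.
Qed.

(** The functional equation of Gamma at m = k + 5 / 2: minus [gam k.+1] has derivative [gam k.+1] -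
    m [gam k] and vanishes at 0 and at infinity. That derivative changes sign at m, so [0, m] is
    handled by the fundamental theorem on a compact interval and [m, oo[ by the one for nonnegative
    integrands. *)
Let IgamS k : Igam k.+1 = ((k%:R + 5 / 2)%:E * Igam k)%E.
Proof.
pose m : R := k%:R + 5 / 2.
have m0 : 0 < m by rewrite /m ltr_wpDl// divr_gt0.
pose f t := gam k.+1 t - m * gam k t.
have fE t : f t = gam k t * (t - m) by rewrite /f /gam exprS; ring.
have cf : continuous f.
  move=> t; apply: cvgB; first exact: continuous_gam.
  by apply: cvgM; [exact: cvg_cst|exact: continuous_gam].
have mf A : measurable_fun (A : set MR) (EFin \o f).
  apply/measurable_funTS/measurable_EFinP; exact: (continuous_measurable_fun cf).
have dF (t : R) : 0 < t -> is_derive t 1 (fun t => - gam k.+1 t) (f t).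
  exact: is_derive_gam.
have cF : continuous (fun t => - gam k.+1 t).
  by move=> t; apply: cvgN; exact: continuous_gam.
have i1 : (\int[lam]_(t in `[0%R, m]) (f t)%:E = (- gam k.+1 m)%:E - (- gam k.+1 0)%:E)%E.
  apply: (@continuous_FTC2 _ f (fun t => - gam k.+1 t)) => //.
  - exact: continuous_subspaceT.
  - split.
    + move=> t; rewrite in_itv/= => /andP[t0 _].
      by have h := dF t t0; exact: ex_derive.
    + by apply: cvg_at_right_filter; exact: cF.
    + by apply: cvg_at_left_filter; exact: cF.
  - move=> t; rewrite in_itv/= => /andP[t0 _].
    by have h := dF t t0; rewrite derive1E; exact: derive_val.
have i2 : (\int[lam]_(t in `[m, +oo[) (f t)%:E = 0%:E - (- gam k.+1 m)%:E)%E.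
  apply: (@ge0_continuous_FTC2y _ f (fun t => - gam k.+1 t)).
  - move=> t mt; rewrite fE mulr_ge0 ?subr_ge0// gam_ge0//.
    exact: le_trans (ltW m0) mt.
  - exact: continuous_subspaceT.
  - by rewrite -[X in _ --> X]oppr0; apply: cvgN; exact: cvg_gam.
  - by move=> t mt; have h := dF t (lt_trans m0 mt); exact: ex_derive.
  - by apply: cvg_at_right_filter; exact: cF.
  - move=> t; rewrite in_itv/= andbT => mt.
    by have h := dF t (lt_trans m0 mt); rewrite derive1E; exact: derive_val.
have i0 : (\int[lam]_(t in ray) (f t)%:E = 0)%E.
  rewrite /ray (@itv_bndbnd_setU _ _ (BLeft 0) (BLeft m) (BInfty _ false)) ?bnd_simp ?ltW//.
  rewrite integral_setU//; last first.
    apply/disj_setPS => z /= []; rewrite !in_itv/= andbT => /andP[_ h1] h2.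
    by move: (lt_le_trans h1 h2); rewrite ltxx.
  transitivity (\int[lam]_(t in `[0%R, m]) (f t)%:E
      + \int[lam]_(t in `[m, +oo[) (f t)%:E)%E.
    rewrite -(@integral_itv_bndo_bndc _ (BLeft 0) m (EFin \o f))//.
    exact: mf.
  rewrite i1 i2 /gam sqrtr0 mulr0 mul0r.
  by rewrite -!EFinB -EFinD; congr EFin; ring.
have i3 : (\int[lam]_(t in ray) (f t)%:E = Igam k.+1 - m%:E * Igam k)%E.
  have h1 := integrable_gam k.+1; have h0 := integrable_gam k.
  have h2 : lam.-integrable ray (EFin \o (fun t => m * gam k t)).
    exact: (integrableZl measurable_ray m h0).
  rewrite (_ : (m%:E * Igam k)%E = \int[lam]_(t in ray) (m * gam k t)%:E)%E.
    exact: (integralB_EFin measurable_ray h1 h2).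
  exact/esym/(integralZl measurable_ray h0).
have := i3; rewrite i0 => /esym/eqP; rewrite sube_eq ?add0e.
- by move=> /eqP.
- exact: Igam_fin.
- by rewrite fin_num_adde_defl// fin_numM// Igam_fin.
Qed.

Let Igam_gt0 : (0 < Igam 0)%E.
Proof.
have c0 : 0 < expR (- 2) :> R by exact: expR_gt0.
apply: (@lt_le_trans _ _ (\int[lam]_(t in `[1%R, 2%R]) (expR (- 2))%:E)%E).
  rewrite integral_cst//= lebesgue_measure_itv/= lte_fin.
  by rewrite ltr1n -EFinB -EFinM lte_fin mulr_gt0// subr_gt0 ltr1n.
apply: (@le_trans _ _ (\int[lam]_(t in `[1%R, 2%R]) (gam 0 t)%:E)%E).
  apply: ge0_le_integral => //.
  - apply: (measurable_funS measurable_ray); last exact: measurable_gam.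
    by move=> t; rewrite /ray/= !in_itv/=; lra.
  - move=> t; rewrite /= in_itv/= => /andP[t1 t2]; rewrite lee_fin /gam expr1.
    have h : expR (- 2) <= expR (- t) by rewrite ler_expR; lra.
    have s1 : 1 <= Num.sqrt t by rewrite -[X in X <= _]sqrtr1 ler_sqrt; lra.
    apply: (le_trans h); rewrite ler_peMl ?expR_ge0//.
    by rewrite mulr_ege1.
apply: ge0_subset_integral => //.
- exact: measurable_gam.
- by move=> t; rewrite /ray/= in_itv/= andbT => t0; rewrite lee_fin gam_ge0.
- by move=> t; rewrite /ray/= !in_itv/=; lra.
Qed.

(** The argument keeps the shape index + nu + 1, with nu = 3 / 2, that [besselI] produces; the
    integrand is t^(k + 3 / 2) exp (- t). *)
Lemma GammaE (k : nat) : Gamma (k%:R + 3 / 2 + 1) = fine (Igam k).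
Proof.
rewrite /Gamma /Igam /ray; congr fine.
rewrite -(@integral_itv_obnd_cbnd _ 0); last first.
  apply: (measurable_funS measurable_ray); last exact: measurable_gam.
  by move=> t; rewrite /ray/= !in_itv/= !andbT => /ltW.
apply: eq_integral => t; rewrite inE/= in_itv/= andbT => t0.
congr EFin; rewrite /gam; congr (_ * _).
rewrite (_ : k%:R + 3 / 2 + 1 - 1 = k.+1%:R + 2^-1); last by rewrite -natr1; field.
rewrite powRD; last by rewrite (gt_eqF t0) implybT.
by rewrite powR_mulrn ?powR12_sqrt// ltW.
Qed.

Let gamma_seq (k : nat) : R := fine (Igam k).

Let gamma_seqS k : gamma_seq k.+1 = (k%:R + 5 / 2) * gamma_seq k.
Proof. by rewrite /gamma_seq IgamS fineM. Qed.

Let gamma_seq_gt0 k : 0 < gamma_seq k.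
Proof.
elim: k => [|k ih]; last first.
  by rewrite gamma_seqS mulr_gt0// ltr_wpDl// divr_gt0.
by rewrite -lte_fin /gamma_seq fineK ?Igam_fin.
Qed.

(** These are the terms of 3 (t cosh t - sinh t) / t^3 expanded in powers of t. *)
Let bessel_term (t : R) (k : nat) : R := 6 * k.+1%:R / (2 * k + 3)%N`!%:R * t ^+ (2 * k)%N.

Let bessel_termE (t : R) k : 0 < t ->
  gamma_seq 0 * ((t / 2) `^ (2 * k%:R + 3 / 2) / (k`!%:R * gamma_seq k)) / (t / 2) `^ (3 / 2)
  = bessel_term t k.
Proof.
move=> t0.
have p0 : 0 < (t / 2) `^ (3 / 2) by apply: powR_gt0; rewrite divr_gt0.
have t2 : t / 2 != 0 by rewrite gt_eqF// divr_gt0.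
rewrite powRD; last by rewrite t2 implybT.
rewrite -natrM powR_mulrn; last by rewrite ltW// divr_gt0.
transitivity (gamma_seq 0 / gamma_seq k * (t / 2) ^+ (2 * k)%N / k`!%:R).
  have f0 : k`!%:R != 0 :> R by rewrite pnatr_eq0 -lt0n fact_gt0.
  have g0 := gamma_seq_gt0 k.
  by field; rewrite f0 !gt_eqF.
elim: k => [|k ih].
  rewrite divff ?gt_eqF ?gamma_seq_gt0// muln0 !expr0 /bessel_term fact0 muln0.
  by rewrite expr0 add0n (_ : 3`! = 6%N)//; field.
have g0 := gamma_seq_gt0 k.
have f0 : k`!%:R != 0 :> R by rewrite pnatr_eq0 -lt0n fact_gt0.
have f1 : (2 * k + 3)%N`!%:R != 0 :> R by rewrite pnatr_eq0 -lt0n fact_gt0.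
have k0 : 0 <= k%:R :> R by rewrite ler0n.
(* The ratio of consecutive terms, t^2 / ((2 k + 2) (2 k + 5)), is the same on both sides. *)
transitivity ((gamma_seq 0 / gamma_seq k * (t / 2) ^+ (2 * k)%N / k`!%:R) *
    (t ^+ 2 / ((2 * k%:R + 2) * (2 * k%:R + 5)))).
  rewrite gamma_seqS factS natrM mulnS exprD -natr1.
  have h1 : k%:R + 1 != 0 :> R by rewrite gt_eqF// ltr_wpDl.
  have h2 : k%:R * 2 + 5 != 0 :> R by rewrite gt_eqF// ltr_wpDl// mulr_ge0.
  by field; rewrite ?f0 ?h1 ?h2 ?gt_eqF//; lra.
rewrite ih /bessel_term mulnS exprD (_ : 2 + 2 * k + 3 = (2 * k + 3).+2)%N; last first.
  by rewrite -addnA add2n.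
rewrite !factS !natrM -!natr1 natrD natrM.
have h1 : 2 * k%:R + 2 != 0 :> R by rewrite gt_eqF// ltr_wpDl// mulr_ge0.
have h2 : 2 * k%:R + 5 != 0 :> R by rewrite gt_eqF// ltr_wpDl// mulr_ge0.
have h3 : 2 * k%:R + 4 != 0 :> R by rewrite gt_eqF// ltr_wpDl// mulr_ge0.
by field; rewrite ?f1; lra.
Qed.

(** Truncating the exponential series after 2 N + 2 terms, at exponent 2 N + 1, makes the identity
    exact for partial sums: even and odd parts separate, the linear terms cancel, and the powers
    left are those of the first [N] terms. *)
Let esum_bessel (t : R) N : t ^+ 3 * (series (bessel_term t)) N =
  3 / 2 * (t * (series (exp_coeff t) (2 * N + 2)%N + series (exp_coeff (- t)) (2 * N + 2)%N)
   - (series (exp_coeff t) (2 * N + 2)%N - series (exp_coeff (- t)) (2 * N + 2)%N)).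
Proof.
elim: N => [|N ih].
  rewrite muln0 add0n /series /exp_coeff/= !big_nat_recr//= !big_geq//=.
  by rewrite !fact0 !factS !fact0; field.
rewrite (_ : 2 * N.+1 + 2 = (2 * N + 2).+2)%N; last by rewrite mulnS -addnA add2n.
have bS : series (bessel_term t) N.+1 = series (bessel_term t) N + bessel_term t N.
  by rewrite /series/= big_nat_recr.
have eS u n : series (exp_coeff u) n.+1 = series (exp_coeff u) n + u ^+ n / n`!%:R.
  by rewrite /series/= big_nat_recr.
rewrite bS mulrDr ih !eS.
have sgn0 : (- t) ^+ (2 * N + 2)%N = t ^+ (2 * N + 2)%N.
  by rewrite exprNn -signr_odd oddD oddM/= expr0 mul1r.
have sgn1 : (- t) ^+ (2 * N + 2)%N.+1 = - t ^+ (2 * N + 2)%N.+1.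
  by rewrite exprS sgn0 exprS mulNr.
rewrite sgn0 sgn1 /bessel_term (_ : 2 * N + 3 = (2 * N + 2).+1)%N; last by rewrite addnS.
rewrite !factS natrM -[(2 * N + 2)%N.+1%:R]natr1 natrD natrM -[N.+1%:R]natr1.
rewrite !exprS exprD.
have f1 : (2 * N + 2)%N`!%:R != 0 :> R by rewrite pnatr_eq0 -lt0n fact_gt0.
have h1 : 2 * N%:R + 2 + 1 != 0 :> R.
  by rewrite gt_eqF// !ltr_wpDl// !addr_ge0// mulr_ge0.
by field; rewrite f1.
Qed.

(** Passing to the limit in [esum_bessel] gives 3 (t cosh t - sinh t) / t^3. For t = mu r this is
    the mean of [sinhc (mu * edist y x0)] over the ball of radius r around [x0], which is how the
    Bessel factor meets the integral over the ball. *)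
Lemma a3plusE (t : R) : 0 < t ->
  a3plus t = 3 / (2 * t ^+ 3) * ((t - 1) * expR t + (t + 1) * expR (- t)).
Proof.
move=> t0; have tN0 : t != 0 by rewrite gt_eqF.
have G0 : Gamma (5 / 2) = gamma_seq 0.
  by rewrite /gamma_seq -GammaE; congr Gamma; field.
have p0 : 0 < (t / 2) `^ (3 / 2) by apply: powR_gt0; rewrite divr_gt0.
have cvgE u : series (exp_coeff u) (2 * N + 2)%N @[N --> \oo] --> expR u.
  apply: (@cvg_comp _ _ _ (fun N => 2 * N + 2)%N (series (exp_coeff u)) _ \oo).
    apply/cvgnyPge => A; near=> n.
    have : (A <= n)%N by near: n; exact: nbhs_infty_ge.
    by move=> /leq_trans; apply; rewrite mul2n -addnn -addnA leq_addr.
  exact: is_cvg_series_exp_coeff.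
have cB : series (bessel_term t) @ \oo --> 
    3 / (2 * t ^+ 3) * ((t - 1) * expR t + (t + 1) * expR (- t)).
  rewrite (_ : series (bessel_term t) = fun N => (t ^+ 3)^-1 * (3 / 2 *
    (t * (series (exp_coeff t) (2 * N + 2)%N + series (exp_coeff (- t)) (2 * N + 2)%N)
     - (series (exp_coeff t) (2 * N + 2)%N - series (exp_coeff (- t)) (2 * N + 2)%N)))); last first.
    by apply/funext => N; rewrite -esum_bessel mulKf// expf_neq0.
  rewrite (_ : 3 / _ * _ = (t ^+ 3)^-1 * (3 / 2 * (t * (expR t + expR (- t))
     - (expR t - expR (- t))))); last by field.
  apply: cvgM; first exact: cvg_cst.
  apply: cvgM; first exact: cvg_cst.
  apply: cvgB; last by apply: cvgB; exact: cvgE.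
  apply: cvgM; first exact: cvg_cst.
  by apply: cvgD; exact: cvgE.
pose u k := (t / 2) `^ (2 * k%:R + 3 / 2) / (k`!%:R * Gamma (k%:R + 3 / 2 + 1)).
have uE k : u k = (t / 2) `^ (3 / 2) / gamma_seq 0 * bessel_term t k.
  rewrite -bessel_termE// /u GammaE -/(gamma_seq k).
  have g0 := gamma_seq_gt0 0; have gk := gamma_seq_gt0 k.
  have f0 : k`!%:R != 0 :> R by rewrite pnatr_eq0 -lt0n fact_gt0.
  by field; rewrite f0 !gt_eqF.
have sE : series u = (fun N => (t / 2) `^ (3 / 2) / gamma_seq 0 * series (bessel_term t) N).
  by apply/funext => N; rewrite /series/= mulr_sumr; apply: eq_bigr => k _.
rewrite /a3plus /besselI G0 -/u sE.
rewrite (cvg_lim _ (cvgM (cvg_cst _) cB))//.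
have g0 := gamma_seq_gt0 0.
by field; rewrite tN0 !gt_eqF.
Unshelve. all: by end_near. Qed.

End bessel.

(** * Exponential and hyperbolic inequalities *)

Section inequalities.
Context (R : realType).

(** Positivity of the derivative is asked only inside the interval because in most uses it vanishes
    at the left endpoint. *)
Lemma is_derive_gt0_lt (f df : R -> R) (a b : R) : a < b ->
  (forall x : R, is_derive x 1 f (df x)) ->
  (forall x : R, a < x < b -> 0 < df x) -> f a < f b.
Proof.
move=> ab dF df0.
have cF : {within `[a, b], continuous f}.
  by apply: continuous_subspaceT => x; exact: (is_derive_continuous (dF x)).
have [z] := MVT ab (fun x _ => dF x) cF.
rewrite in_itv/= => zab e.
by rewrite -subr_gt0 e mulr_gt0 ?subr_gt0 ?df0.
Qed.

(** Since a >= 0, 1 + b <= (1 + a) (1 + (b - a)), and the last factor is below exp (b - a). This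
    makes the shell constant positive. *)
Lemma expR_poly1_lt (a b : R) : 0 <= a -> a < b ->
  (1 + b) * expR (- b) < (1 + a) * expR (- a).
Proof.
move=> a0 ab.
have h : 1 + (b - a) < expR (b - a) by rewrite expR_gt1Dx// gt_eqF// subr_gt0.
rewrite (_ : - a = b - a + - b); last by ring.
by rewrite expRD mulrA ltr_pM2r ?expR_gt0//; nra.
Qed.

Lemma expR_sub_gt0 (t : R) : 0 < t -> 0 < expR t - expR (- t).
Proof. by move=> t0; rewrite subr_gt0 ltr_expR; lra. Qed.

(** Half of the expression is t cosh t - sinh t, with derivative t sinh t. It is the numerator both
    in [a3plus] and in the derivative of [sinhc]. *)
Lemma sinh_lt_mul_cosh (t : R) : 0 < t -> 0 < (t - 1) * expR t + (t + 1) * expR (- t).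
Proof.
move=> t0.
pose f (t : R) := (t - 1) * expR (1 * t) + (t + 1) * expR (-1 * t).
suff : f 0 < f t by rewrite /f !mul1r !mulN1r oppr0 expR0; lra.
apply: (@is_derive_gt0_lt _ (fun t => t * (expR t - expR (- t)))) => //.
  move=> x; have h1 := is_derive_expRM 1 x; have h2 := is_derive_expRM (-1) x.
  by apply: is_derive_eq; rewrite /GRing.scale/= !mul1r !mulN1r; ring.
by move=> x /andP[x0 _]; rewrite mulr_gt0// expR_sub_gt0.
Qed.

Lemma id_lt_sinh (t : R) : 0 < t -> 2 * t < expR t - expR (- t).
Proof.
move=> t0.
pose f (t : R) := expR (1 * t) - expR (-1 * t) - 2 * t.
suff : f 0 < f t by rewrite /f !mul1r !mulN1r oppr0 expR0; lra.
apply: (@is_derive_gt0_lt _ (fun t => expR t + expR (- t) - 2)) => //.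
  move=> x; have h1 := is_derive_expRM 1 x; have h2 := is_derive_expRM (-1) x.
  by apply: is_derive_eq; rewrite /GRing.scale/= !mul1r !mulN1r; ring.
move=> x /andP[x0 _].
have h1 : 1 + x < expR x by rewrite expR_gt1Dx// gt_eqF.
by have := expR_ge1Dx (- x); lra.
Qed.

Lemma sinhc_gt0 (t : R) : 0 <= t -> 0 < sinhc t.
Proof.
move=> t0; rewrite /sinhc; case: eqVneq => // tN0.
have {}t0 : 0 < t by rewrite lt_neqAle eq_sym tN0.
by rewrite divr_gt0 ?expR_sub_gt0// mulr_gt0.
Qed.

Lemma sinhc_lt (s t : R) : 0 <= s -> s < t -> sinhc s < sinhc t.
Proof.
move=> s0 st; have t0 : 0 < t by lra.
rewrite /sinhc (gt_eqF t0); case: eqVneq => [_|sN0].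
  by rewrite ltr_pdivlMr ?mulr_gt0// mul1r id_lt_sinh.
have {}s0 : 0 < s by rewrite lt_neqAle eq_sym sN0.
(* [t |-> s * sinh t - t * sinh s] vanishes at [s], with derivative at least
   [s * cosh s - sinh s] on the right of [s]. *)
pose f (t : R) := s * (expR (1 * t) - expR (-1 * t)) - t * (expR s - expR (- s)).
suff : f s < f t.
  rewrite /f !mul1r !mulN1r => h.
  by rewrite ltr_pdivrMr ?mulr_gt0// mulrAC ltr_pdivlMr ?mulr_gt0//; lra.
apply: (@is_derive_gt0_lt _
  (fun t => s * (expR t + expR (- t)) - (expR s - expR (- s)))) => //.
  move=> x; have h1 := is_derive_expRM 1 x; have h2 := is_derive_expRM (-1) x.
  by apply: is_derive_eq; rewrite /GRing.scale/= !mul1r !mulN1r; ring.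
move=> x /andP[sx _]; have := sinh_lt_mul_cosh s0 => h.
suff : expR s + expR (- s) <= expR x + expR (- x) by nra.
have e1 : expR (- s) * expR s = 1 by rewrite -expRD addNr expR0.
have e2 : expR (- x) * expR x = 1 by rewrite -expRD addNr expR0.
have l1 : expR s < expR x by rewrite ltr_expR.
(* cosh increases because exp (- s) - exp (- x) is exp x - exp s times a factor below 1. *)
have e4 : expR (- s) - expR (- x) = expR (- s) * expR (- x) * (expR x - expR s).
  by rewrite mulrBr -mulrA e2 mulr1 mulrAC e1 mul1r.
have e5 : expR (- s) * expR (- x) < 1.
  by rewrite -expRD expR_lt1; lra.
have : expR (- s) * expR (- x) * (expR x - expR s) <= 1 * (expR x - expR s).
  by rewrite ler_pM2r ?subr_gt0 1?ltW.
by rewrite -e4; lra.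
Qed.

(* The difference of the two sides of the identity for [E-] at an interior point,
   as a function of the scaled radius [p], has derivative
   [p * sinh (p - d)] and vanishes at [p = d]. *)
Lemma interior_ineq (d p : R) : 0 < d -> d < p ->
  2 * d < ((p - 1) * expR p + (p + 1) * expR (- p)) * expR (- d)
     + (1 + p) * expR (- p) * (expR d - expR (- d)).
Proof.
move=> d0 dp.
pose f (p : R) := ((p - 1) * expR (1 * p) + (p + 1) * expR (-1 * p)) * expR (- d)
     + (1 + p) * expR (-1 * p) * (expR d - expR (- d)).
have e : expR d * expR (- d) = 1 by rewrite -expRD subrr expR0.
suff : f d < f p.
  rewrite /f !mul1r !mulN1r; apply: le_lt_trans.
  suff -> : 2 * d = ((d - 1) * expR d + (d + 1) * expR (- d)) * expR (- d) +
    (1 + d) * expR (- d) * (expR d - expR (- d)) by [].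
  transitivity (2 * d * (expR d * expR (- d))); first by rewrite e mulr1.
  by ring.
apply: (@is_derive_gt0_lt _
  (fun p => p * (expR p * expR (- d) - expR d * expR (- p)))) => //.
  move=> x; have h1 := is_derive_expRM 1 x; have h2 := is_derive_expRM (-1) x.
  by apply: is_derive_eq; rewrite /GRing.scale/= !mul1r !mulN1r; ring.
move=> x /andP[dx _]; rewrite -!expRD mulr_gt0//; first by lra.
by rewrite subr_gt0 ltr_expR; lra.
Qed.

End inequalities.

(** * Potentials of balls and shells around [x0] *)

Section potentials.
Context (R : realType).
Local Notation MR := (measurableTypeR R).
Local Notation MR3 := ((MR * MR) * MR)%type.
Local Notation c := (disc_area R).
Variables (mu : R) (x0 : R3 R).
Hypothesis mu0 : 0 < mu.

Lemma EminusC (x y : R3 R) : Eminus mu x y = Eminus mu y x.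
Proof. by rewrite /Eminus edist3C. Qed.

Lemma Eminus_ge0 (x y : R3 R) : 0 <= Eminus mu x y.
Proof. by rewrite divr_ge0 ?expR_ge0 ?edist3_ge0. Qed.

Lemma measurable_Eminus_pair :
  measurable_fun setT (fun p : MR3 * MR3 => Eminus mu p.1 p.2 : MR).
Proof.
apply: measurable_funM; last first.
  apply: measurable_inv_nneg; first exact: measurable_edist_pair.
  by move=> y; exact: edist3_ge0.
rewrite (_ : (fun x => _) = (fun t => expR (- mu * t)) \o
  (fun p : MR3 * MR3 => Defs.edist p.1 p.2)); last first.
  by apply/funext => p /=; rewrite mulNr.
apply: (measurableT_comp (f := (fun t => expR (- mu * t)) : MR -> MR)); last first.
  exact: measurable_edist_pair.
exact: (continuous_measurable_fun (continuous_expRM (k := - mu))).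
Qed.

Lemma measurable_Eminus (x : R3 R) (A : set MR3) :
  measurable_fun A (fun y : MR3 => (Eminus mu y x)%:E).
Proof.
apply/measurable_funTS/measurable_EFinP.
have m : measurable_fun setT (fun y : MR3 => (y, x : MR3)).
  exact: measurable_fun_pair.
exact: (measurableT_comp measurable_Eminus_pair m).
Qed.

(** The difference of the [sinhc] coefficients of the ball potentials of radii [M1] and [M2], hence
    the potential of the shell at its centre. *)
Definition shell_const (M1 M2 : R) : R := 4 * c / mu ^+ 2 *
  ((1 + mu * M1) * expR (- (mu * M1)) - (1 + mu * M2) * expR (- (mu * M2))).

Lemma shell_const_gt0 (M1 M2 : R) : 0 < M1 -> M1 < M2 -> 0 < shell_const M1 M2.
Proof.
move=> M10 M12; rewrite /shell_const mulr_gt0//.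
  by rewrite divr_gt0 ?exprn_gt0// mulr_gt0// disc_area_gt0.
by rewrite subr_gt0 expR_poly1_lt ?mulr_ge0 ?ltW// ltr_pM2l.
Qed.

Definition shell (M1 M2 : R) : set (R3 R) := eball x0 M2 `\` eball x0 M1.

Lemma measurable_shell M1 M2 : measurable (shell M1 M2 : set MR3).
Proof. by apply: measurableD; exact: measurable_eball. Qed.

(* Newton's shell theorem for the Yukawa kernel, at interior points. *)
Lemma shell_potentialE (M1 M2 : R) (y : R3 R) : edist y x0 < M1 -> M1 < M2 ->
  (\int[@lebesgue3 R]_(x in shell M1 M2) (Eminus mu y x)%:E =
   (shell_const M1 M2 * sinhc (mu * edist y x0))%:E)%E.
Proof.
move=> yM M12.
have h1 := ball_potentialE mu0 yM.
have h2 := ball_potentialE mu0 (lt_trans yM M12).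
have sub : eball x0 M1 `<=` eball x0 M2.
  by move=> z; rewrite /eball/= => zM; exact: lt_trans M12.
have e := setDUK sub.
have mB M : measurable (eball x0 M : set MR3) by exact: measurable_eball.
rewrite -e ge0_integral_setU// in h2; last 4 first.
- exact: measurable_shell.
- exact: measurable_Eminus.
- by move=> z _; rewrite lee_fin Eminus_ge0.
- by apply/disj_setPS => z [] ? [].
under eq_integral do rewrite EminusC.
rewrite h1 in h2; rewrite -/(shell M1 M2) in h2.
have -> : shell_const M1 M2 * sinhc (mu * edist y x0) =
    ball_potential mu M2 (edist y x0) - ball_potential mu M1 (edist y x0).
  by rewrite /shell_const /ball_potential; ring.
by rewrite EFinB -h2 addeAC subee// add0e.
Qed.

Lemma measurable_sinh_div : measurable_fun [set: MR3] (fun y : MR3 =>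
  ((expR (mu * edist y x0) - expR (- mu * edist y x0)) / (2 * mu)) / edist y x0).
Proof.
have md := measurable_edist x0.
apply: measurable_funM; last first.
  by apply: measurable_inv_nneg => // y; exact: edist3_ge0.
apply: measurable_funM => //; apply: measurable_funB.
  apply: (measurableT_comp (f := (fun t => expR (mu * t)) : MR -> MR)) => //.
  exact: (continuous_measurable_fun (continuous_expRM (k := mu))).
apply: (measurableT_comp (f := (fun t => expR (- mu * t)) : MR -> MR)) => //.
exact: (continuous_measurable_fun (continuous_expRM (k := - mu))).
Qed.

Lemma measurable_point3 (x : R3 R) : measurable [set x : MR3].
Proof.
rewrite (_ : [set x] = (fun y : MR3 => edist y x : MR) @^-1` [set 0]).
  rewrite -[X in measurable X]setTI.
  exact: (measurable_edist x measurableT (measurable_set1 (0 : R))).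
apply/seteqP; split => [z ->/=|z /=]; first exact: edist3xx.
exact: edist3_eq0.
Qed.

Lemma lebesgue3_point (x : R3 R) : @lebesgue3 R [set x : MR3] = 0%E.
Proof.
apply/eqP; rewrite eq_le measure_ge0 andbT.
apply: (@le_trans _ _ (@lebesgue3 R ([set: MR * MR] `*` [set x.2]))).
  apply: le_measure; rewrite ?inE; [exact: measurable_point3| |by move=> z ->].
  by apply: measurableX => //; exact: (measurable_set1 (x.2 : R)).
rewrite /lebesgue3 product_measure1E//.
by rewrite /= lebesgue_measure_set1 mule0.
Qed.

(** The quotient reads 0 at [x0], where [sinhc] is 1. The indicator repairs this one point, so that
    measurability follows from that of the quotient. *)
Lemma sinhc_edistE (y : R3 R) : sinhc (mu * edist y x0) = \1_[set x0] y +
  ((expR (mu * edist y x0) - expR (- mu * edist y x0)) / (2 * mu)) / edist y x0.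
Proof.
rewrite indicE /sinhc mulf_eq0 (gt_eqF mu0)/= mulNr.
have [e|e] := eqVneq (edist y x0) 0.
  by rewrite mem_set ?e ?invr0 ?mulr0 ?addr0//; exact: edist3_eq0.
rewrite memNset; last by move=> /= yx; rewrite yx edist3xx eqxx in e.
by rewrite add0r; field; rewrite e gt_eqF.
Qed.

Lemma measurable_sinhc_edist (A : set MR3) :
  measurable_fun A (fun y : MR3 => (sinhc (mu * edist y x0))%:E).
Proof.
apply/measurable_funTS/measurable_EFinP.
rewrite (_ : (fun y => _) = (fun y => \1_[set x0 : MR3] y +
    ((expR (mu * edist y x0) - expR (- mu * edist y x0)) / (2 * mu)) / edist y x0)).
  apply: measurable_funD; last exact: measurable_sinh_div.
  by apply: measurable_indic; exact: measurable_point3.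
by apply/funext => y; exact: sinhc_edistE.
Qed.

Lemma integral_eball_sinhcE (r : R) : 0 < r ->
  (\int[@lebesgue3 R]_(y in eball x0 r) (sinhc (mu * edist y x0))%:E =
   (2 * c / mu ^+ 3 * ((mu * r - 1) * expR (mu * r) + (mu * r + 1) * expR (- (mu * r))))%:E)%E.
Proof.
move=> r0; rewrite -[- (mu * r)]mulNr -(integral_eball_sinhc x0 mu0 r0).
have mB : measurable (eball x0 r : set MR3) by exact: measurable_eball.
have m1 := measurable_point3 x0.
have f0 y : (0 <= ((expR (mu * edist y x0) - expR (- mu * edist y x0)) /
    (2 * mu) / edist y x0)%:E)%E.
  have h := mulr_ge0 (ltW mu0) (edist3_ge0 y x0).
  rewrite lee_fin !divr_ge0 ?edist3_ge0 ?mulr_ge0 ?(ltW mu0)//.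
  by rewrite subr_ge0 ler_expR mulNr; lra.
rewrite (ge0_negligible_integral m1)//; last 3 first.
- exact: measurable_sinhc_edist.
- by move=> y _; rewrite lee_fin ltW// sinhc_gt0// mulr_ge0 ?edist3_ge0 ?ltW.
- exact: lebesgue3_point.
rewrite [RHS](ge0_negligible_integral m1)//; last 2 first.
- by apply/measurable_funTS/measurable_EFinP; exact: measurable_sinh_div.
- exact: lebesgue3_point.
apply: eq_integral => y; rewrite inE => -[_ /= yx].
by rewrite sinhc_edistE indicE memNset// add0r.
Qed.

End potentials.

(** Extension by 0 outside the rectangle reduces the claim to Tonelli on the whole product; it is
    applied to the shell against [D]. *)
Lemma ge0_tonelli_setX (d1 d2 : measure_display) (T1 : measurableType d1)
    (T2 : measurableType d2) (R : realType)
    (m1 : {sigma_finite_measure set T1 -> \bar R})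
    (m2 : {sigma_finite_measure set T2 -> \bar R}) (A : set T1) (B : set T2)
    (f : T1 * T2 -> \bar R) :
  measurable A -> measurable B -> measurable_fun setT f ->
  (forall p, 0 <= f p)%E ->
  (\int[m1]_(x in A) \int[m2]_(y in B) f (x, y) =
   \int[m2]_(y in B) \int[m1]_(x in A) f (x, y))%E.
Proof.
move=> mA mB mf f0; pose F := f \_ (A `*` B).
have mF : measurable_fun setT F.
  apply/(measurable_restrictT _ _).1; first exact: measurableX.
  exact: measurable_funTS.
have F0 p : (0 <= F p)%E by rewrite /F patchE; case: ifP.
transitivity (\int[m1]_x \int[m2]_y F (x, y))%E.
  rewrite integral_mkcond; apply: eq_integral => x _; rewrite patchE.
  case: ifPn => xA.
    rewrite integral_mkcond; apply: eq_integral => y _.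
    rewrite !patchE; congr (if _ then _ else _).
    by rewrite in_setX xA.
  rewrite integral0_eq// => y _; rewrite /F patchE ifF//; apply/negP.
  by rewrite inE => -[/= Ax _]; move: xA; rewrite notin_setE.
rewrite fubini_tonelli// [RHS]integral_mkcond; apply: eq_integral => y _.
rewrite patchE; case: ifPn => yB.
  rewrite [RHS]integral_mkcond; apply: eq_integral => x _.
  rewrite !patchE; congr (if _ then _ else _).
  by rewrite in_setX yB andbT.
rewrite integral0_eq// => x _; rewrite /F patchE ifF//; apply/negP.
by rewrite inE => -[_ /= By]; move: yB; rewrite notin_setE.
Qed.

(** * Comparison of [D] with the ball *)

Section identification.
Context (R : realType).
Local Notation MR := (measurableTypeR R).
Local Notation MR3 := ((MR * MR) * MR)%type.
Local Notation c := (disc_area R).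
Variables (mu : R) (x0 : R3 R).
Hypothesis mu0 : 0 < mu.

(* Integrate the hypothesis over a shell surrounding [D]: both sides are
   multiples of the same constant by the shell theorem. *)
Lemma integral_sinhc_of_Eminus (D : set MR3) (M A V : R) :
  measurable D -> 0 < M -> D `<=` eball x0 M -> 0 <= A -> 0 < V ->
  (forall x, ~ D x -> (A * Eminus mu x x0)%:E =
     ((V^-1)%:E * \int[@lebesgue3 R]_(y in D) (Eminus mu y x)%:E)%E) ->
  (\int[@lebesgue3 R]_(y in D) (sinhc (mu * edist y x0))%:E = (V * A)%:E)%E.
Proof.
move=> mD M0 DM A0 V0 h.
pose W := shell x0 M (M + 1); pose K := shell_const mu M (M + 1).
have M1 : M < M + 1 by rewrite ltrDl.
have K0 : 0 < K by exact: shell_const_gt0.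
have mW : measurable (W : set MR3) by exact: measurable_shell.
have V1 : 0 < V^-1 by rewrite invr_gt0.
have l : (\int[@lebesgue3 R]_(x in W) (A * Eminus mu x x0)%:E = (A * K)%:E)%E.
  under eq_integral do rewrite EFinM.
  rewrite ge0_integralZl//; last 2 first.
  - exact: measurable_Eminus.
  - by move=> x _; rewrite lee_fin Eminus_ge0.
  under eq_integral do rewrite EminusC.
  (* The shell potential is evaluated at [x0] itself, where the [sinhc] factor is 1. *)
  rewrite shell_potentialE ?edist3xx//.
  by rewrite mulr0 /sinhc eqxx mulr1 -EFinM.
have mE : measurable_fun setT (fun p : MR3 * MR3 => (Eminus mu p.2 p.1)%:E).
  under eq_fun do rewrite EminusC.
  by apply/measurable_EFinP; exact: measurable_Eminus_pair.
have r : (\int[@lebesgue3 R]_(x in W) (A * Eminus mu x x0)%:E =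
    (V^-1)%:E * (K%:E * \int[@lebesgue3 R]_(y in D) (sinhc (mu * edist y x0))%:E))%E.
  transitivity (\int[@lebesgue3 R]_(x in W)
    ((V^-1)%:E * \int[@lebesgue3 R]_(y in D) (Eminus mu y x)%:E))%E.
    (* Points of the shell are at distance at least [M] from [x0], hence outside [D], where the
       identity is available. *)
    apply: eq_integral => x; rewrite inE => -[_ xM]; apply: h => Dx.
    by apply: xM; exact: DM.
  rewrite ge0_integralZl//; last 3 first.
  - apply: measurable_funTS.
    rewrite (_ : (fun x => _) = (fun x => \int[@lebesgue3 R]_y
      (((fun p : MR3 * MR3 => (Eminus mu p.2 p.1)%:E) \_ (setT `*` D)) (x, y)))%E).
      apply: (measurable_fun_fubini_tonelli_F (m2 := @lebesgue3 R)).
        apply/(measurable_restrictT _ _).1; first exact: measurableX.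
        exact: measurable_funTS.
      by move=> p; rewrite patchE; case: ifP => // _; rewrite lee_fin Eminus_ge0.
    apply/funext => x; rewrite integral_mkcond; apply: eq_integral => y _.
    rewrite !patchE; congr (if _ then _ else _).
    by rewrite in_setX in_setT.
  - by move=> x _; apply: integral_ge0 => y _; rewrite lee_fin Eminus_ge0.
  - by rewrite lee_fin ltW.
  congr (_ * _)%E.
  rewrite (@ge0_tonelli_setX _ _ _ _ _ (@lebesgue3 R) (@lebesgue3 R) W D
    (fun p => (Eminus mu p.2 p.1)%:E))//; last first.
    by move=> p; rewrite lee_fin Eminus_ge0.
  rewrite -ge0_integralZl//; last 3 first.
  - exact: measurable_sinhc_edist.
  - by move=> y _; rewrite lee_fin ltW// sinhc_gt0// mulr_ge0 ?edist3_ge0 ?ltW.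
  - by rewrite lee_fin ltW.
  apply: eq_integral => y; rewrite inE => Dy.
  by rewrite shell_potentialE//; exact: DM.
rewrite r in l.
transitivity ((V / K)%:E * (A * K)%:E)%E; last first.
  by rewrite -EFinM; congr EFin; field; rewrite gt_eqF.
rewrite -l muleA muleA -!EFinM (_ : _ * _ * _ = 1) ?mul1e//.
by field; rewrite !gt_eqF.
Qed.

(* [sinhc] is smaller inside the ball than outside, so among sets of the volume
   of the ball only the ball itself, up to a null set, has the integral of the
   ball. *)
Lemma bathtub (D : set MR3) (r : R) : 0 < r -> measurable D ->
  @lebesgue3 R D = @lebesgue3 R (eball x0 r) ->
  (\int[@lebesgue3 R]_(y in D) (sinhc (mu * edist y x0))%:E =
   \int[@lebesgue3 R]_(y in eball x0 r) (sinhc (mu * edist y x0))%:E)%E ->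
  @lebesgue3 R (eball x0 r `\` D) = 0%E /\ @lebesgue3 R (D `\` eball x0 r) = 0%E.
Proof.
move=> r0 mD vol int.
set B := eball x0 r in vol int *.
have mB : measurable (B : set MR3) by exact: measurable_eball.
have mBD : measurable (B `\` D) by exact: measurableD.
have mDB : measurable (D `\` B) by exact: measurableD.
have mDI : measurable (D `&` B) by exact: measurableI.
have volB : (@lebesgue3 R B < +oo)%E by rewrite leb3_eball// ltry.
pose f (y : MR3) : \bar R := (sinhc (mu * edist y x0))%:E.
have f0 y : (0 <= f y)%E.
  by rewrite lee_fin ltW// sinhc_gt0// mulr_ge0 ?edist3_ge0 ?ltW.
have mf A : measurable_fun A f by exact: measurable_sinhc_edist.
pose s := sinhc (mu * r).
have s0 : 0 < s by rewrite sinhc_gt0// mulr_ge0 ?ltW.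
(* The common part of [D] and [B] has finite volume and can be cancelled; [intE] does the same for
   the integrals. *)
have volE : @lebesgue3 R (B `\` D) = @lebesgue3 R (D `\` B).
  have finI : @lebesgue3 R (D `&` B) \is a fin_num.
    rewrite ge0_fin_numE//; apply: le_lt_trans volB.
    by apply: le_measure; rewrite ?inE//; exact: subIsetr.
  have vD (X Y : set MR3) : measurable X -> measurable Y -> @lebesgue3 R X =
      (@lebesgue3 R (X `\` Y) + @lebesgue3 R (X `&` Y))%E by exact: measureDI.
  have h1 := vD _ _ mD mB; have h2 := vD _ _ mB mD.
  rewrite vol h2 [B `&` D]setIC in h1.
  by rewrite -(addeK (@lebesgue3 R (B `\` D)) finI) h1 addeK.
have intI : (\int[@lebesgue3 R]_(y in D `&` B) f y \is a fin_num)%E.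
  rewrite ge0_fin_numE; last exact: integral_ge0.
  apply: (@le_lt_trans _ _ (\int[@lebesgue3 R]_(y in B) f y)%E).
    by apply: ge0_subset_integral => //; exact: subIsetr.
  by rewrite integral_eball_sinhcE// ltry.
have split (A C : set MR3) : measurable A -> measurable C ->
    (\int[@lebesgue3 R]_(y in A) f y = \int[@lebesgue3 R]_(y in A `\` C) f y
      + \int[@lebesgue3 R]_(y in A `&` C) f y)%E.
  move=> mA mC; rewrite -ge0_integral_setU//; first by rewrite setUC setUIDK.
  - exact: measurableD.
  - exact: measurableI.
  - by apply/disj_setPS => z [] [_ ?] [].
have intE : (\int[@lebesgue3 R]_(y in B `\` D) f y =
    \int[@lebesgue3 R]_(y in D `\` B) f y)%E.
  have h1 := split _ _ mD mB; have h2 := split _ _ mB mD.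
  have e : (\int[@lebesgue3 R]_(y in D) f y = \int[@lebesgue3 R]_(y in B) f y)%E.
    exact: int.
  rewrite e h2 [B `&` D]setIC in h1.
  by rewrite -(addeK (\int[@lebesgue3 R]_(y in B `\` D) f y)%E intI) h1 addeK.
suff z : @lebesgue3 R (B `\` D) = 0%E by split=> //; rewrite -volE.
have fs (y : MR3) : (B `\` D) y -> sinhc (mu * edist y x0) < s.
  move=> [yr _]; rewrite sinhc_lt ?mulr_ge0 ?edist3_ge0 ?ltW//.
  by rewrite ltr_pM2l.
(* The two set differences have equal volume and equal integral of [f]. Outside the ball [f] is at
   least [s], inside it is below [s]; hence [g] is nonnegative on the part of [B] outside [D] and
   its integral there is 0, although it is positive at every point of that part. *)
pose g (y : MR3) : \bar R := (s%:E - f y)%E.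
have mg A : measurable_fun A g by exact: emeasurable_funB.
have g0 (y : MR3) : (B `\` D) y -> (0 <= g y)%E.
  by move=> /fs h; rewrite /g /f -EFinB lee_fin subr_ge0 ltW.
have volF : @lebesgue3 R (B `\` D) \is a fin_num.
  rewrite ge0_fin_numE//; apply: le_lt_trans volB.
  by apply: le_measure; rewrite ?inE//; exact: subDsetl.
have sD : (\int[@lebesgue3 R]_(y in B `\` D) f y +
    \int[@lebesgue3 R]_(y in B `\` D) g y = s%:E * @lebesgue3 R (B `\` D))%E.
  rewrite -ge0_integralD//.
  rewrite -integral_cst//; apply: eq_integral => y _.
  by rewrite /g addeC subeK.
have sle : (s%:E * @lebesgue3 R (B `\` D) <= \int[@lebesgue3 R]_(y in B `\` D) f y)%E.
  rewrite volE intE -integral_cst//.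
  apply: ge0_le_integral => //; first by move=> y _; rewrite lee_fin ltW.
  move=> y [_ /negP]; rewrite -leNgt le_eqVlt => /orP[/eqP e|h].
    by rewrite /f -e.
  rewrite lee_fin ltW// sinhc_lt ?ltr_pM2l//.
  by rewrite mulr_ge0 ?ltW.
have sF : (\int[@lebesgue3 R]_(y in B `\` D) f y \is a fin_num)%E.
  rewrite ge0_fin_numE; last exact: integral_ge0.
  apply: (@le_lt_trans _ _ (\int[@lebesgue3 R]_(y in B) f y)%E).
    by apply: ge0_subset_integral => //; exact: subDsetl.
  by rewrite integral_eball_sinhcE// ltry.
have ig : (\int[@lebesgue3 R]_(y in B `\` D) `|g y| = 0)%E.
  transitivity (\int[@lebesgue3 R]_(y in B `\` D) g y)%E.
    by apply: eq_integral => y; rewrite inE => h; rewrite gee0_abs// g0.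
  apply/eqP; rewrite eq_le integral_ge0// andbT.
  by rewrite -(leeD2lE _ _ sF) adde0 sD.
have /(ae_eq_integral_abs (@lebesgue3 R) mBD (mg _)) [N [mN N0 hN]] := ig.
apply: (subset_measure0 (B := N)) => // y By; apply: hN => /= h.
have := h By; rewrite /g /f -EFinB => -[/eqP]; rewrite subr_eq0 => /eqP e.
by have := fs y By; rewrite -e ltxx.
Qed.

(* A point of [D] outside the ball can be pushed radially outwards, where [D]
   contains a small ball disjoint from the large one. *)
Lemma open_sub_eball (D : set (R3 R)) (r : R) : 0 < r -> open D ->
  @lebesgue3 R (D `\` eball x0 r) = 0%E -> D `<=` eball x0 r.
Proof.
move=> r0 oD null y Dy; apply: contrapT => /negP; rewrite -leNgt => ry.
have [e e0 he] := eball_sub_open oD Dy.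
set d := edist y x0 in ry; have d0 : 0 < d by exact: lt_le_trans ry.
(* Chosen so that z lies e / 2 beyond y on the ray from [x0]. The ball of radius e / 2 around z then
   stays within distance e of y and beyond distance d of [x0]. *)
pose t := e / (2 * d); have t0 : 0 < t by rewrite divr_gt0// mulr_gt0.
pose z : R3 R := (y.1.1 + t * (y.1.1 - x0.1.1), y.1.2 + t * (y.1.2 - x0.1.2),
  y.2 + t * (y.2 - x0.2)).
have td : t * d = e / 2 by rewrite /t; field; rewrite gt_eqF.
have zy : edist z y = e / 2.
  apply/eqP; rewrite -(@eqrXn2 _ 2) ?edist3_ge0 ?divr_ge0 ?ltW// -td exprMn.
  by rewrite /d !sqr_edist/=; apply/eqP; ring.
have zx : edist z x0 = d + e / 2.
  apply/eqP; rewrite -(@eqrXn2 _ 2) ?edist3_ge0 ?addr_ge0 ?divr_ge0 ?ltW// -td.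
  rewrite (_ : d + t * d = (1 + t) * d); last by ring.
  by rewrite exprMn /d !sqr_edist/=; apply/eqP; ring.
have e2 : 0 < e / 2 by rewrite divr_gt0.
have : (0 < @lebesgue3 R (eball z (e / 2)))%E.
  by rewrite leb3_eball// lte_fin !mulr_gt0 ?disc_area_gt0 ?exprn_gt0 ?divr_gt0.
rewrite ltNge => /negP; apply; rewrite -null.
apply: le_measure; rewrite ?inE; first exact: measurable_eball.
  by apply: measurableD; [exact: measurable_open3|exact: measurable_eball].
move=> w; rewrite {1}/eball/= => wz; split.
  by apply: he; rewrite /eball/=; have := edist3_triangle z w y; lra.
rewrite /eball/= => wr.
by have := edist3_triangle w z x0; rewrite (edist3C z w); lra.
Qed.

(** At a missing point the null differences let the potential of [D] be replaced by that of the
    ball, and the identity would turn [interior_ineq], taken at mu d and mu r, into an equality. *)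
Lemma eball_sub_of_Eminus (D : set MR3) (r : R) : 0 < r -> measurable D -> D x0 ->
  @lebesgue3 R (eball x0 r `\` D) = 0%E -> @lebesgue3 R (D `\` eball x0 r) = 0%E ->
  (forall x, ~ D x -> (a3plus (mu * r) * Eminus mu x x0)%:E =
     (((c * (4 / 3 * r ^+ 3))^-1)%:E *
      \int[@lebesgue3 R]_(y in D) (Eminus mu y x)%:E)%E) ->
  eball x0 r `<=` D.
Proof.
move=> r0 mD Dx0 n1 n2 h x xr; apply: contrapT => Dx.
have mB : measurable (eball x0 r : set MR3) by exact: measurable_eball.
have mBD : measurable (eball x0 r `\` D : set MR3) by exact: measurableD.
have mDB : measurable (D `\` eball x0 r) by exact: measurableD.
have E0 (A : set MR3) y : A y -> (0 <= (Eminus mu y x)%:E)%E.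
  by rewrite lee_fin Eminus_ge0.
have {h} := h x Dx.
have -> : (\int[@lebesgue3 R]_(y in D) (Eminus mu y x)%:E =
    \int[@lebesgue3 R]_(y in eball x0 r) (Eminus mu y x)%:E)%E.
  rewrite (ge0_negligible_integral mDB mD (@measurable_Eminus R mu x _) (E0 D) n2).
  rewrite (ge0_negligible_integral mBD mB (@measurable_Eminus R mu x _) (E0 _) n1).
  by rewrite !setDD setIC.
rewrite ball_potentialE// -EFinM => -[].
have dx0 : 0 < edist x x0 by apply: edist3_gt0 => xx0; apply: Dx; rewrite xx0.
set d := edist x x0 in xr dx0 *.
have {}xr : d < r := xr.
have p0 : 0 < mu * r by rewrite mulr_gt0.
have q0 : 0 < mu * d by rewrite mulr_gt0.
have := @interior_ineq R (mu * d) (mu * r) q0; rewrite ltr_pM2l// => /(_ xr).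
rewrite a3plusE// /Eminus -/d /ball_potential /sinhc (gt_eqF q0).
set e1 := expR (mu * r); set e2 := expR (- (mu * r)).
set e3 := expR (mu * d); set e4 := expR (- (mu * d)) => lt eq.
have c0 := disc_area_gt0 R.
(* The multiplier, which is the prefactor 3 / (2 (mu r)^3) of [a3plus] divided by d, scales 2 mu d
   to the constant part of the ball potential per unit volume. *)
have : 3 / (2 * mu ^+ 3 * r ^+ 3 * d) * (2 * (mu * d)) =
  3 / (2 * mu ^+ 3 * r ^+ 3 * d) * (((mu * r - 1) * e1 + (mu * r + 1) * e2) * e4 +
    (1 + mu * r) * e2 * (e3 - e4)).
  rewrite mulrDr (_ : 3 / _ * (_ * e4) = 3 / (2 * (mu * r) ^+ 3) *
    ((mu * r - 1) * e1 + (mu * r + 1) * e2) * (e4 / d)); last first.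
    by field; rewrite !gt_eqF.
  by rewrite eq; field; rewrite !gt_eqF.
have k0 : 3 / (2 * mu ^+ 3 * r ^+ 3 * d) != 0.
  by rewrite gt_eqF// divr_gt0// !mulr_gt0 ?exprn_gt0.
by move=> /(mulfI k0) e; rewrite -e ltxx in lt.
Qed.

End identification.

Unset Implicit Arguments.

Theorem theorem2 (R : realType) (mu : R) (D : set (R3 R)) (r : R) (x0 : R3 R) :
  0 < mu ->
  open D -> connected D -> ebounded D -> connected (~` D) ->
  0 < r -> @leb3 R (eball x0 r) = @leb3 R D ->
  D x0 ->
  (forall x, (~` D) x ->
     (a3plus (mu * r) * Eplus mu x x0)%:E =
       (((fine (@leb3 R D))^-1)%:E * \int[@leb3 R]_(y in D) (Eplus mu y x)%:E)%E) ->
  (forall x, (~` D) x ->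
     (a3plus (mu * r) * Eminus mu x x0)%:E =
       (((fine (@leb3 R D))^-1)%:E * \int[@leb3 R]_(y in D) (Eminus mu y x)%:E)%E) ->
  D = eball x0 r.
Proof.
move=> mu0 oD _ [M hM] _ r0 vol Dx0 _ h.
have mD := measurable_open3 oD.
have p0 : 0 < mu * r by rewrite mulr_gt0.
rewrite !leb3E in vol h.
have volB := leb3_eball x0 r0.
have V0 : 0 < disc_area R * (4 / 3 * r ^+ 3).
  by rewrite !mulr_gt0 ?disc_area_gt0 ?exprn_gt0.
rewrite -vol volB /= in h.
have A0 : 0 <= a3plus (mu * r).
  rewrite a3plusE// mulr_ge0//; last by rewrite ltW// sinh_lt_mul_cosh.
  by rewrite divr_ge0// mulr_ge0// exprn_ge0// ltW.
(* The given bound is measured from the origin. Adding the distance from the origin to [x0]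
   recentres it, and the final 1 makes the inequality strict and the radius positive. *)
have DM : D `<=` eball x0 (`|M| + edist 0 x0 + 1).
  move=> y Dy; rewrite /eball/=.
  have := edist3_triangle 0 y x0; have := hM y Dy; have := ler_norm M; lra.
have M0 : 0 < `|M| + edist 0 x0 + 1 by rewrite ltr_wpDl// addr_ge0 ?edist3_ge0.
have intD := integral_sinhc_of_Eminus mu0 mD M0 DM A0 V0 h.
have intE : (\int[@lebesgue3 R]_(y in D) (sinhc (mu * edist y x0))%:E =
   \int[@lebesgue3 R]_(y in eball x0 r) (sinhc (mu * edist y x0))%:E)%E.
  rewrite integral_eball_sinhcE//; apply: (etrans intD); congr EFin.
  by rewrite a3plusE//; field; rewrite !gt_eqF.
have [n1 n2] := bathtub mu0 r0 mD (esym vol) intE.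
apply/seteqP; split; first exact: open_sub_eball n2.
exact: eball_sub_of_Eminus h.
Qed.
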